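(* For all integers $k_1,l_1,k_2,l_2\ge0$ there is a bijection between $\mathcal{M}(k_1,l_1,k_2,l_2)$ and the set of pairs $(P,Q)$ such that $P$ is a hook composition tableau with letters from $\{1,\dots,k_1\}\cup\{1',\dots,l_1'\}$, $Q$ is a hook composition tableau with letters from $\{1,\dots,k_2\}\cup\{1',\dots,l_2'\}$, and the shapes of $P$ and $Q$ rearrange to the same partition. The bijection is weight preserving: if $M\mapsto(P,Q)$, then for each column label $c$ the number of entries $c$ in $P$ equals the sum of the entries of column $c$ of $M$, and for each row label $r$ the number of entries $r$ in $Q$ equals the sum of the entries of row $r$ of $M$.
   Context: $\mathcal{M}(k_1,l_1,k_2,l_2)$ is the set of $(k_2+l_2)\times(k_1+l_1)$ matrices $M$ whose rows are labeled $1,\dots,k_2,1',\dots,l_2'$ (top to bottom) and whose columns are labeled $1,\dots,k_1,1',\dots,l_1'$ (left to right), such that the entries in the block of unprimed rows and unprimed columns ($k_2\times k_1$) and in the block of primed rows and primed columns ($l_2\times l_1$) are nonnegative integers, while the entries in the block of unprimed rows and primed columns ($k_2\times l_1$) and the block of primed rows and unprimed columns ($l_2\times k_1$) are $0$ or $1$. For an alphabet $\mathcal{A}=\{1,\dots,k\}$, $\mathcal{A}'=\{1',\dots,l'\}$ ordered $1<\dots<k<1'<\dots<l'$, a hook composition tableau (HCT) of composition shape $\alpha=(\alpha_1,\dots,\alpha_r)$ (largest part $m$; French notation, $\alpha_i$ cells in row $i$ from the bottom, cell $(i,j)$ in row $i$, column $j$) is a filling $F$ with letters of $\mathcal{A}\cup\mathcal{A}'$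 such that rows weakly increase left to right; unprimed entries weakly and primed strictly increase along rows; in the leftmost column unprimed entries strictly and primed weakly increase bottom to top; and with $\hat F$ the $r\times m$ array with $\infty$ (larger than all letters, in neither alphabet) in missing cells, for $1\le i<j\le r$, $1\le n<m$: (a) if $\hat F(i,n+1)\in\mathcal{A}$ and $\hat F(i,n+1)\ge\hat F(j,n)$ then $\hat F(i,n+1)>\hat F(j,n+1)$; (b) if $\hat F(i,n+1)\in\mathcal{A}'$ and $\hat F(i,n+1)>\hat F(j,n)$ then $\hat F(i,n+1)\ge\hat F(j,n+1)$. The shape of $F$ rearranges to a partition $\lambda$ if sorting the parts of $\alpha$ into weakly decreasing order gives $\lambda$.
   Formalization: The leftmost column of a hook composition tableau is required to increase weakly as a whole, so unprimed entries lie below primed ones; if a primed entry could lie below an unprimed one, the claim would fail, e.g. for k1=l1=k2=l2=1 with each letter used once (2 matrices, 5 pairs). *)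

(* Defs.v *)
From mathcomp Require Import all_boot all_order all_algebra.

Set Implicit Arguments.
Unset Strict Implicit.
Unset Printing Implicit Defensive.

(* The alphabet 1 < .. < k < 1' < .. < l' is 'I_(k + l) with its natural
   order: the letter c is c - 1 (via lshift) and the letter c' is k + c - 1
   (via rshift). Row and column labels of matrices are encoded in the same
   way. The value k + l stands for the entry oo: it exceeds every letter and
   satisfies neither of the two predicates below. *)
Definition unprimed (k : nat) : pred nat := fun x => x < k.
Definition primed (k l : nat) : pred nat := fun x => k <= x < k + l.

(* The block of unprimed rows is on top, the block of unprimed columns is on
   the left. *)
Definition is_hook_matrix (k1 l1 k2 l2 : nat)
    (M : 'M[nat]_(k2 + l2, k1 + l1)) : bool :=
  [forall i, forall j, ursubmx M i j <= 1] &&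
  [forall i, forall j, dlsubmx M i j <= 1].

Definition hook_matrix (k1 l1 k2 l2 : nat) : Type :=
  {M : 'M[nat]_(k2 + l2, k1 + l1) | is_hook_matrix M}.

(* A filling is the list of its rows, from bottom to top (French notation);
   rows and columns are numbered from 0. *)
Definition filling (k l : nat) : Type := seq (seq 'I_(k + l)).

Section HookCompositionTableaux.

Variables k l : nat.
Implicit Type F : filling k l.

Definition shape_of F : seq nat := [seq size s | s <- F].

Definition is_composition (a : seq nat) : bool := all (leq 1) a.

Definition largest_part F : nat := \max_(a <- shape_of F) a.

Definition hat F (i j : nat) : nat :=
  nth (k + l) [seq val x | x <- nth [::] F i] j.

Definition row_cond (s : seq nat) : bool :=
  [&& sorted leq s,
      sorted leq [seq x <- s | unprimed k x]
    & sorted ltn [seq x <- s | primed k l x]].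

(* The first column weakly increases as a whole, so that its unprimed entries
   lie below its primed ones. *)
Definition column_cond (s : seq nat) : bool :=
  [&& sorted leq s,
      sorted ltn [seq x <- s | unprimed k x]
    & sorted leq [seq x <- s | primed k l x]].

Definition first_column F : seq nat := [seq hat F i 0 | i <- iota 0 (size F)].

Definition triple_cond_a F (i j n : nat) : bool :=
  unprimed k (hat F i n.+1) && (hat F j n <= hat F i n.+1)
    ==> (hat F j n.+1 < hat F i n.+1).

Definition triple_cond_b F (i j n : nat) : bool :=
  primed k l (hat F i n.+1) && (hat F j n < hat F i n.+1)
    ==> (hat F j n.+1 <= hat F i n.+1).

Definition is_hct F : bool :=
  [&& is_composition (shape_of F),
      all (fun s => row_cond [seq val x | x <- s]) F,
      column_cond (first_column F)
    & [forall i : 'I_(size F), forall j : 'I_(size F),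
       forall n : 'I_(largest_part F).-1,
         (i < j) ==> triple_cond_a F i j n && triple_cond_b F i j n]].

Definition hct : Type := {F : filling k l | is_hct F}.

Definition shape_partition (P : hct) : seq nat := sort geq (shape_of (val P)).

Definition weight (P : hct) (c : 'I_(k + l)) : nat :=
  count_mem c (flatten (val P)).

End HookCompositionTableaux.

Definition hct_pair (k1 l1 k2 l2 : nat) : Type :=
  {PQ : hct k1 l1 * hct k2 l2
      | shape_partition PQ.1 == shape_partition PQ.2}.

(* Main.v *)
(** Sorting the row lengths of the subtableaux formed by the letters below a given
    one, and conjugating, turns a hook composition tableau into a chain of
    partitions in which an unprimed letter adds a vertical strip and a primed one a
    horizontal strip. Conversely the triple conditions leave exactly one way to
    distribute the cells of a given strip over the rows: going from the top row
    down, an unprimed letter gives a row all the missing cells that continue it,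
    and a primed letter gives at most one cell, the topmost among rows of equal
    length being served first. So pairs of tableaux are pairs of chains with the
    same last partition, and these correspond to matrices by growth diagrams: in a
    square with corners k (top left), a, b and l, the partitions a, b together with
    l determine k and the matrix entry m, and conversely. The local rule depends
    on the kinds of the two strips, and m is restricted to 0 and 1 exactly when
    they differ. *)
Require Import Defs.
From mathcomp Require Import all_boot all_order all_algebra.
From mathcomp Require Import zify.

Set Implicit Arguments.
Unset Strict Implicit.
Unset Printing Implicit Defensive.

(** * Partitions and their conjugates *)

Definition is_part (p : seq nat) : bool := sorted geq p && (0 \notin p).

(** A partition is handled as the function [nth 0 p], weakly decreasing and eventually 0; this turns
    such a function back into a list. *)
Definition part_of (f : nat -> nat) (N : nat) : seq nat :=
  [seq x <- mkseq f N | 0 < x].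

Lemma geq_trans : transitive geq.
Proof. by move=> a b c /= h1 h2; exact: leq_trans h2 h1. Qed.

Lemma part_geq p i j : is_part p -> i <= j -> nth 0 p j <= nth 0 p i.
Proof.
move=> /andP[sp _] le_ij; have [lt_j | le_j] := ltnP j (size p); last first.
  by rewrite nth_default.
have lt_i := leq_ltn_trans le_ij lt_j.
by apply: (sorted_leq_nth geq_trans leqnn 0 sp).
Qed.

Lemma part_gt0 p i : is_part p -> (0 < nth 0 p i) = (i < size p).
Proof.
move=> /andP[_ p0]; case: (ltnP i (size p)) => [lt_i | le_i]; last by rewrite nth_default.
by rewrite lt0n; apply: contraNneq p0 => <-; apply: mem_nth.
Qed.

Lemma eq_from_ltn m n : (forall j, (j < m) = (j < n)) -> m = n.
Proof. by move=> h; have := h m; have := h n; rewrite !ltnn; lia. Qed.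

Lemma part_ext p q : is_part p -> is_part q ->
  (forall i, nth 0 p i = nth 0 q i) -> p = q.
Proof.
move=> pp pq e; apply: (@eq_from_nth _ 0) => //.
by apply: eq_from_ltn => i; rewrite -!part_gt0 // e.
Qed.

Lemma nth_filter_pos s i : sorted geq s ->
  nth 0 [seq x <- s | 0 < x] i = nth 0 s i.
Proof.
elim: s i => [|[|x] s IH] i //= ps; last first.
  by case: i => //= i; apply: IH; apply: path_sorted ps.
have /all_pred1P es : all (pred1 0) s.
  by move: (order_path_min geq_trans ps); apply: sub_all => y /=; rewrite leqn0.
rewrite es; case: i => [|i]; rewrite /= ?nth_nseq ?if_same.
  by rewrite (_ : filter _ _ = [::]) //; elim: (size s) => //.
by rewrite (_ : filter _ _ = [::]) ?nth_nil //; elim: (size s) => //.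
Qed.

Lemma sorted_mkseq_geq (f : nat -> nat) N :
  (forall i, f i.+1 <= f i) -> sorted geq (mkseq f N).
Proof.
move=> fd; apply/(sortedP 0) => i; rewrite size_mkseq => lt_i.
by rewrite nth_mkseq ?(ltnW lt_i) // nth_mkseq //=; apply: fd.
Qed.

Lemma part_of_part (f : nat -> nat) N :
  (forall i, f i.+1 <= f i) -> is_part (part_of f N).
Proof.
move=> fd; rewrite /is_part mem_filter ltnn /= andbT.
by apply: sorted_filter; [apply: geq_trans | apply: sorted_mkseq_geq].
Qed.

Lemma nth_part_of (f : nat -> nat) N i : (forall i, f i.+1 <= f i) -> f N = 0 ->
  nth 0 (part_of f N) i = f i.
Proof.
move=> fd fN; rewrite nth_filter_pos ?sorted_mkseq_geq //.
have [lt_i | le_i] := ltnP i N; first by rewrite nth_mkseq.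
rewrite nth_default ?size_mkseq //; symmetry; apply/eqP; rewrite -leqn0 -{}fN.
elim: i le_i => [|i IH]; first by rewrite leqn0 => /eqP->.
by rewrite leq_eqVlt ltnS => /orP[/eqP-> // | /IH]; apply: leq_trans.
Qed.

Lemma sumn_nth p N : size p <= N -> sumn p = \sum_(i < N) nth 0 p i.
Proof.
elim: p N => [|x p IH] N; first by rewrite big1 // => i _; rewrite nth_nil.
by case: N => // N h; rewrite big_ord_recl /= (IH N).
Qed.

(** [R] may come in any order: the columns of left-justified rows are counted, so conjugation sorts
    on the way. No part exceeds [sumn R]. *)
Definition conjugate (R : seq nat) : seq nat :=
  part_of (fun p => count (ltn p) R) (sumn R).

Lemma count_gt_dec R p : count (ltn p.+1) R <= count (ltn p) R.
Proof. by apply: sub_count => x /=; apply: ltnW. Qed.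

Lemma count_gt_sumn R p : sumn R <= p -> count (ltn p) R = 0.
Proof.
elim: R => //= x R IH h; rewrite IH ?(leq_trans _ h) ?leq_addl // addn0.
by rewrite ltnNge (leq_trans _ h) ?leq_addr.
Qed.

Lemma conj_part R : is_part (conjugate R).
Proof. exact: part_of_part (count_gt_dec R). Qed.

Lemma nth_conj R p : nth 0 (conjugate R) p = count (ltn p) R.
Proof. by apply: nth_part_of; [apply: count_gt_dec | apply: count_gt_sumn]. Qed.

(** In a weakly decreasing list the parts larger than [i] form an initial segment. *)
Lemma lt_count_gt p i j : is_part p -> (j < count (ltn i) p) = (i < nth 0 p j).
Proof.
case/andP=> sp _; elim: p j sp => [|x p IH] j //= sp; first by rewrite nth_nil.
have sp' := path_sorted sp.
case: (ltnP i x) => h; first by case: j => [|j] //=; rewrite add1n ltnS IH.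
have -> : count (ltn i) p = 0.
  apply/eqP; rewrite -leqn0 leqNgt -has_count; apply/hasPn => y yp /=.
  by move/allP: (order_path_min geq_trans sp) => /(_ y yp) /=; lia.
case: j => [|j] /=; first by lia.
rewrite ltn0; symmetry; apply/negbTE; rewrite -leqNgt.
have [lt_j | le_j] := ltnP j (size p); last by rewrite nth_default.
by move/allP: (order_path_min geq_trans sp) => /(_ _ (mem_nth 0 lt_j)) /=; lia.
Qed.

Lemma lt_nth_conj p i j : is_part p -> (j < nth 0 (conjugate p) i) = (i < nth 0 p j).
Proof. by move=> pp; rewrite nth_conj lt_count_gt. Qed.

Lemma conjK p : is_part p -> conjugate (conjugate p) = p.
Proof.
move=> pp; apply: part_ext => //; first exact: conj_part.
by move=> i; apply: eq_from_ltn => j; rewrite lt_nth_conj ?conj_part // lt_nth_conj.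
Qed.

Lemma sumn_conj R : sumn (conjugate R) = sumn R.
Proof.
rewrite (@sumn_nth _ (sumn R)); last first.
  rewrite leqNgt -part_gt0 ?conj_part // nth_conj count_gt_sumn //.
(* Double counting of cells: a part [x] contributes one cell to each of the first [x] columns. *)
have gen N : sumn R <= N -> \sum_(i < N) count (ltn i) R = sumn R.
  elim: R => [|x R IH] /= h; first by rewrite big1.
  rewrite big_split /= IH ?(leq_trans _ h) ?leq_addl //; congr addn.
  have -> : \sum_(i < N) nat_of_bool (ltn i x) = minn x N; last by lia.
  by elim: N {h IH} => [|N IHN]; rewrite ?big_ord0 ?minn0 // big_ord_recr /= IHN; lia.
by rewrite -[RHS](gen (sumn R)) //; apply: eq_bigr => i _; rewrite nth_conj.
Qed.

(** Differences of the counts [count (ltn x)] are the multiplicities of the positive parts, so the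
    conjugate determines the list up to order once 0 is excluded. *)
Lemma conj_inj_sort R R' : 0 \notin R -> 0 \notin R' ->
  (conjugate R == conjugate R') = (sort geq R == sort geq R').
Proof.
move=> R0 R'0; have tg : total geq by move=> x y /=; apply: leq_total.
have ag : antisymmetric geq by move=> x y /=; rewrite andbC => /anti_leq.
apply/eqP/eqP => [e | e].
  apply/(perm_sortP tg geq_trans ag); apply/allP => x _ /=; apply/eqP.
  case: x => [|x]; first by rewrite !(count_memPn _).
  have h S : count (ltn x) S = count_mem x.+1 S + count (ltn x.+1) S.
    by elim: S => //= y S ->; rewrite /= eq_sym; case: ltngtP => h; lia.
  have e' y : count (ltn y) R = count (ltn y) R' by rewrite -!nth_conj e.
  by apply: (@addIn (count (ltn x.+1) R)); rewrite -h e' h e'.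
have pe : perm_eq R R' by apply/(perm_sortP tg geq_trans ag).
apply: part_ext; try exact: conj_part.
by move=> i; rewrite !nth_conj; move/permP: pe => /(_ (ltn i)).
Qed.

(** * Local growth rules *)

Local Notation "p .[ i ]" := (nth 0 p i) : nat_scope.

Definition vstrip (p q : seq nat) : Prop := forall i, p.[i] <= q.[i] <= (p.[i]).+1.
Definition hstrip (p q : seq nat) : Prop := forall i, q.[i.+1] <= p.[i] <= q.[i].

Definition step (h : bool) (p q : seq nat) : Prop :=
  [/\ is_part p, is_part q & if h then hstrip p q else vstrip p q].

Lemma step_le h p q i : step h p q -> p.[i] <= q.[i].
Proof. by case=> _ _; case: h => /(_ i) /andP[]. Qed.

Lemma step_refl h p : is_part p -> step h p p.
Proof. by move=> pp; split=> //; case: h => i; rewrite ?leqnn ?leqnSn ?part_geq. Qed.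

Lemma step_nil h p : step h p [::] -> p = [::].
Proof.
move=> st; have [pp _ _] := st; apply: part_ext => // i.
by have := step_le i st; rewrite nth_nil leqn0 => /eqP.
Qed.

Lemma step_conj p q : step false p q -> step true (conjugate p) (conjugate q).
Proof.
case=> pp pq v; split; try exact: conj_part; move=> i; apply/andP; split.
  rewrite leqNgt lt_nth_conj // -leqNgt; have := v (nth 0 (conjugate p) i).
  have := lt_nth_conj i (nth 0 (conjugate p) i) pp; lia.
rewrite leqNgt lt_nth_conj // -leqNgt; have := v (nth 0 (conjugate q) i).
have := lt_nth_conj i (nth 0 (conjugate q) i) pq; lia.
Qed.

Lemma step_conj_inv p q : step true p q -> step false (conjugate p) (conjugate q).
Proof.
case=> pp pq v; split; try exact: conj_part; move=> i; apply/andP; split.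
  rewrite leqNgt lt_nth_conj // -leqNgt; have := v (nth 0 (conjugate q) i).
  have := lt_nth_conj i (nth 0 (conjugate q) i) pq; lia.
rewrite leqNgt lt_nth_conj // -leqNgt; have := v (nth 0 (conjugate p) i).
have := lt_nth_conj i (nth 0 (conjugate p) i) pp.
have := part_geq pq (leqnSn (nth 0 (conjugate p) i)).
by lia.
Qed.

(** A square has [k] top left, [b] top right, [a] bottom left and [L k a b m] bottom right; top and
    bottom edges are strips of kind [s], left and right edges of kind [t]. For fixed [a] and [b] the
    rule is a bijection from the pairs [(k, m)] to the possible last corners, and its size balance
    yields the weights. *)
Definition local_rule (s t : bool)
    (L : seq nat -> seq nat -> seq nat -> nat -> seq nat) : Prop :=
  let entry m := (s != t) ==> (m <= 1) in
  [/\ forall k a b m, step t k a -> step s k b -> entry m ->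
        [/\ step s a (L k a b m), step t b (L k a b m) &
            sumn (L k a b m) + sumn k = sumn a + sumn b + m],
      forall a b k m k' m', step t k a -> step s k b -> entry m ->
        step t k' a -> step s k' b -> entry m' ->
        L k a b m = L k' a b m' -> k = k' /\ m = m' &
      forall a b l, step s a l -> step t b l ->
        exists k m, [/\ step t k a, step s k b, entry m & L k a b m = l]].

Lemma local_rule_sym s t L : local_rule s t L ->
  local_rule t s (fun k a b m => L k b a m).
Proof.
case=> L1 L2 L3; split; rewrite (eq_sym t).
- by move=> k a b m ka kb e; case: (L1 k b a m) => // ? ? ?; split=> //; lia.
- by move=> a b k m k' m' ka kb e k'a k'b e'; apply: L2.
by move=> a b l al bl; case: (L3 b a l) => // k [m [? ? ? ?]]; exists k, m; split.
Qed.

(** The RSK local rule in piecewise linear form: [k.[j]] and the new part [j.+1] both lie between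
    [maxn a.[j.+1] b.[j.+1]] and [minn a.[j] b.[j]], and each is the reflection of the other in this
    interval. The entry [m] goes to the first part. *)
Definition rule_hh (k a b : seq nat) (m : nat) : seq nat :=
  part_of (fun i => if i is j.+1
                    then minn a.[j] b.[j] + maxn a.[j.+1] b.[j.+1] - k.[j]
                    else m + maxn a.[0] b.[0])
          (size a + size b).+1.

Lemma rule_hh_dec k a b m : step true k a -> step true k b ->
  let f i := if i is j.+1 then minn a.[j] b.[j] + maxn a.[j.+1] b.[j.+1] - k.[j]
             else m + maxn a.[0] b.[0] in
  forall i, f i.+1 <= f i.
Proof.
case=> pk pa ka [_ pb kb] f [|i] /=; have := ka 0; have := kb 0; first by lia.
have := ka i; have := kb i; have := ka i.+1; have := kb i.+1; lia.
Qed.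

Lemma nth_rule_hh k a b m i : step true k a -> step true k b ->
  (rule_hh k a b m).[i] = if i is j.+1
                    then minn a.[j] b.[j] + maxn a.[j.+1] b.[j.+1] - k.[j]
                    else m + maxn a.[0] b.[0].
Proof.
move=> ka kb; rewrite nth_part_of //; first exact: rule_hh_dec.
by rewrite !(@nth_default _ _ a) ?(@nth_default _ _ b) //; lia.
Qed.

Lemma hh_rule : local_rule true true rule_hh.
Proof.
split.
- move=> k a b m ka kb _; have [pk pa ka'] := ka; have [_ pb kb'] := kb.
  have pl : is_part (rule_hh k a b m) by apply: part_of_part; apply: rule_hh_dec.
  split.
  + split=> // i; rewrite !nth_rule_hh //.
    case: i => [|i]; first by have := ka' 0; have := kb' 0; lia.
    by have := ka' i; have := kb' i; have := ka' i.+1; have := kb' i.+1; lia.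
  + split=> // i; rewrite !nth_rule_hh //.
    case: i => [|i]; first by have := ka' 0; have := kb' 0; lia.
    by have := ka' i; have := kb' i; have := ka' i.+1; have := kb' i.+1; lia.
  pose N := size a + size b + size k + size (rule_hh k a b m).
  rewrite (@sumn_nth (rule_hh _ _ _ _) N.+1) ?(@sumn_nth k N) ?(@sumn_nth a N)
    ?(@sumn_nth b N); try by rewrite /N; lia.
  (* The reflections are summed. Shifting the index of the maxima leaves over [maxn a.[0] b.[0]],
     and minimum plus maximum of a pair is its sum. *)
  have e1 : \sum_(i < N) (rule_hh k a b m).[i.+1] + \sum_(i < N) k.[i] =
      \sum_(i < N) minn a.[i] b.[i] + \sum_(i < N) maxn a.[i.+1] b.[i.+1].
    rewrite -!big_split; apply: eq_bigr => i _ /=.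
    by rewrite nth_rule_hh //; have := ka' i; have := kb' i; lia.
  have e2 : maxn a.[0] b.[0] + \sum_(i < N) maxn a.[i.+1] b.[i.+1] =
      \sum_(i < N) maxn a.[i] b.[i].
    rewrite -(big_ord_recl _ (fun i : 'I_N.+1 => maxn a.[i] b.[i])) big_ord_recr /=.
    by rewrite !(@nth_default _ _ _ N) ?addn0 // /N; lia.
  have e3 : \sum_(i < N) minn a.[i] b.[i] + \sum_(i < N) maxn a.[i] b.[i] =
      \sum_(i < N) a.[i] + \sum_(i < N) b.[i].
    by rewrite -!big_split; apply: eq_bigr => i _ /=; lia.
  have e4 : \sum_(i < N.+1) (rule_hh k a b m).[i] =
      (rule_hh k a b m).[0] + \sum_(i < N) (rule_hh k a b m).[i.+1].
    by rewrite big_ord_recl.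
  by rewrite e4 nth_rule_hh //; lia.
- move=> a b k m k' m' ka kb _ k'a k'b _ e.
  have h i : (rule_hh k a b m).[i] = (rule_hh k' a b m').[i] by rewrite e.
  split; last by have := h 0; rewrite !nth_rule_hh //; lia.
  have [[pk _ ka'] [pk' _ k'a']] := (ka, k'a); have [[_ _ kb'] [_ _ k'b']] := (kb, k'b).
  apply: part_ext => // i; have := h i.+1; rewrite !nth_rule_hh //.
  by have := ka' i; have := kb' i; have := k'a' i; have := k'b' i; lia.
move=> a b l al bl; have [[pa pl al'] [pb _ bl']] := (al, bl).
(* Reflection is an involution, so the same formula recovers [k] from [l]. *)
pose f i := minn a.[i] b.[i] + maxn a.[i.+1] b.[i.+1] - l.[i.+1].
have fd i : f i.+1 <= f i.
  rewrite /f; have := al' i; have := bl' i; have := al' i.+1; have := bl' i.+1.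
  by have := al' i.+2; have := bl' i.+2; lia.
pose N := size a + size b; have fN : f N = 0.
  by rewrite /f /N !(@nth_default _ _ a) ?(@nth_default _ _ b) //; lia.
pose k := part_of f N; have nk i : k.[i] = f i by rewrite nth_part_of.
have pk : is_part k by apply: part_of_part.
have ka : step true k a.
  by split=> // i; rewrite nk /f; have := al' i; have := bl' i; have := al' i.+1; have := bl' i.+1; lia.
have kb : step true k b.
  by split=> // i; rewrite nk /f; have := al' i; have := bl' i; have := al' i.+1; have := bl' i.+1; lia.
exists k, (l.[0] - maxn a.[0] b.[0]); split=> //.
apply: part_ext => //; first by apply: part_of_part; apply: rule_hh_dec.
case=> [|i]; rewrite nth_rule_hh // ?nk /f; first by have := al' 0; have := bl' 0; lia.
by have := al' i; have := bl' i; have := al' i.+1; have := bl' i.+1; lia.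
Qed.

(** Transposing all four corners exchanges the two kinds of strips and keeps the sizes, so the
    previous rule serves. *)
Definition rule_vv (k a b : seq nat) (m : nat) : seq nat :=
  conjugate (rule_hh (conjugate k) (conjugate a) (conjugate b) m).

Lemma vv_rule : local_rule false false rule_vv.
Proof.
have [L1 L2 L3] := hh_rule; split.
- move=> k a b m ka kb _.
  have [] := L1 _ _ _ m (step_conj ka) (step_conj kb) isT.
  move=> /step_conj_inv s1 /step_conj_inv s2; rewrite !sumn_conj.
  by rewrite !conjK in s1 s2; [rewrite -sumn_conj; split| case: kb | case: ka].
- move=> a b k m k' m' ka kb _ k'a k'b _ /(congr1 conjugate).
  rewrite /rule_vv !conjK; try by apply: part_of_part; apply: rule_hh_dec; apply: step_conj.
  have [[pk _ _] [pk' _ _]] := (ka, k'a).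
  move/(L2 _ _ _ _ _ _ (step_conj ka) (step_conj kb) isT (step_conj k'a) (step_conj k'b) isT).
  by case=> /(congr1 conjugate); rewrite !conjK.
move=> a b l al bl; have [k [m [ka kb _ e]]] := L3 _ _ _ (step_conj al) (step_conj bl).
have [[[pa pl _] [pb _ _]] [pk _ _]] := (al, bl, ka).
exists (conjugate k), m; split=> //.
- by rewrite -(conjK pa); apply: step_conj_inv.
- by rewrite -(conjK pb); apply: step_conj_inv.
by rewrite /rule_vv conjK // e conjK.
Qed.

(** Bumping with a carry of at most one cell, from the first row on, starting with the entry [m]. A
    cell of [b] just beyond the row of [a] stays and lets the carry pass; otherwise the carry is
    appended to the row of [a], and a new cell of [b], being covered by [a], is bumped to the next
    row. *)
Fixpoint carry (k a b : seq nat) (m i : nat) : nat :=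
  if i is j.+1
  then if b.[j] == (a.[j]).+1 then carry k a b m j else b.[j] - k.[j]
  else m.

Definition rule_vh (k a b : seq nat) (m : nat) : seq nat :=
  part_of (fun i => if b.[i] == (a.[i]).+1 then b.[i] else a.[i] + carry k a b m i)
          (size a + size b).+1.

Section RuleVH.

Variables (k a b : seq nat) (m : nat).
Hypotheses (ka : step true k a) (kb : step false k b) (m_le1 : m <= 1).

Let pk : is_part k. Proof. by case: ka. Qed.
Let pa : is_part a. Proof. by case: ka. Qed.
Let pb : is_part b. Proof. by case: kb. Qed.
Let ka' i : a.[i.+1] <= k.[i] <= a.[i]. Proof. by case: ka. Qed.
Let kb' i : k.[i] <= b.[i] <= (k.[i]).+1. Proof. by case: kb => _ _ /(_ i). Qed.
Let c := carry k a b m.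

Let c_le1 i : c i <= 1.
Proof. by elim: i => //= i IH; rewrite /c /=; have := kb' i; case: ifP => _ //; lia. Qed.

Let f i := if b.[i] == (a.[i]).+1 then b.[i] else a.[i] + c i.

(** A carry enters row [i.+1] only if [b.[i] = k.[i] + 1], so there is room for it: [a.[i.+1] + 1 <=
    k.[i] + 1 = b.[i]]. *)
Let fb i : f i.+1 <= b.[i].
Proof.
rewrite /f; have := kb' i; have := ka' i; have := part_geq pb (leqnSn i).
by have := c_le1 i; rewrite /c /=; case: eqP => ?; try (case: eqP => ?); lia.
Qed.

Let bf i : b.[i] <= f i.
Proof. by rewrite /f; have := kb' i; have := ka' i; case: eqP; lia. Qed.

Let fd i : f i.+1 <= f i.
Proof. exact: leq_trans (fb i) (bf i). Qed.

Let c_large i : size a + size b < i -> c i = 0.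
Proof. by case: i => // i h; rewrite /c /= (@nth_default _ _ a) ?(@nth_default _ _ b) //; lia. Qed.

Lemma nth_rule_vh i : (rule_vh k a b m).[i] =
  if b.[i] == (a.[i]).+1 then b.[i] else a.[i] + carry k a b m i.
Proof.
rewrite /rule_vh (nth_part_of (f := f)) // /f c_large // !(@nth_default _ _ _ (_.+1)) //; lia.
Qed.

Lemma rule_vh_sound :
  [/\ step false a (rule_vh k a b m), step true b (rule_vh k a b m) &
      sumn (rule_vh k a b m) + sumn k = sumn a + sumn b + m].
Proof.
have pl : is_part (rule_vh k a b m) by apply: part_of_part fd.
split.
- split=> // i; rewrite nth_rule_vh -/c.
  by have := c_le1 i; case: eqP; lia.
- by split=> // i; rewrite !nth_rule_vh; apply/andP; split; [apply: fb | apply: bf].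
pose N := (size a + size b + size k + size (rule_vh k a b m)).+1.
rewrite (@sumn_nth (rule_vh _ _ _ _) N) ?(@sumn_nth k N) ?(@sumn_nth a N)
    ?(@sumn_nth b N); try by rewrite /N; lia.
(* Every row balances once its outgoing carry is counted; the carry is 0 beyond the rows of [a] and
   [b]. *)
have gen n : \sum_(i < n) (rule_vh k a b m).[i] + \sum_(i < n) k.[i] + c n =
             \sum_(i < n) a.[i] + \sum_(i < n) b.[i] + m.
  elim: n => [|n IH]; first by rewrite !big_ord0.
  rewrite !big_ord_recr /=; rewrite nth_rule_vh /c /= in IH *.
  by have := kb' n; have := ka' n; case: eqP; lia.
by have := gen N; rewrite c_large /N; lia.
Qed.

End RuleVH.

Lemma rule_vh_inj k a b m k' m' : step true k a -> step false k b -> m <= 1 ->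
  step true k' a -> step false k' b -> m' <= 1 ->
  rule_vh k a b m = rule_vh k' a b m' -> k = k' /\ m = m'.
Proof.
move=> ka kb m1 k'a k'b m'1 e.
have h i : (rule_vh k a b m).[i] = (rule_vh k' a b m').[i] by rewrite e.
pose N := (size a + size b).+1.
(* The carries are read backwards: they vanish at [N], a row with [b.[j] = a.[j] + 1] passes them
   unchanged, and any other row of the result exceeds [a.[j]] by its incoming carry. *)
have ce i : i <= N -> carry k a b m (N - i) = carry k' a b m' (N - i).
  elim: i => [_|i IH lt_i].
    by rewrite subn0 /= (@nth_default _ _ a) ?(@nth_default _ _ b) //; lia.
  have e1 : N - i = (N - i.+1).+1 by lia.
  move: (IH (ltnW lt_i)); rewrite e1; set j := N - i.+1.
  have := h j; rewrite !nth_rule_vh //=; case: ifP => //; lia.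
have {}ce i : carry k a b m i = carry k' a b m' i.
  case: (leqP i N) => hi; first by have := ce (N - i) (leq_subr _ _); rewrite subKn.
  by case: i hi => // i hi; rewrite /= (@nth_default _ _ a) ?(@nth_default _ _ b) //; rewrite /N in hi; lia.
split; last exact: (ce 0).
have [[pk _ ka'] [_ _ kb']] := (ka, kb); have [[pk' _ k'a'] [_ _ k'b']] := (k'a, k'b).
apply: part_ext => // i; have /= := ce i.+1.
by have := ka' i; have := kb' i; have := k'a' i; have := k'b' i; case: eqP; lia.
Qed.

(* The carry into position [i], read off from the first later position where the
   rule does not merely propagate it. *)
Fixpoint back_carry (a b l : seq nat) (fuel i : nat) : nat :=
  if fuel is n.+1
  then if b.[i] == (a.[i]).+1 then back_carry a b l n i.+1 else l.[i] - a.[i]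
  else 0.

Lemma rule_vh_surj a b l : step false a l -> step true b l ->
  exists k m, [/\ step true k a, step false k b, m <= 1 & rule_vh k a b m = l].
Proof.
move=> al bl; have [[pa pl al'] [pb _ bl']] := (al, bl).
pose N := (size a + size b + size l).+1.
pose c i := back_carry a b l (N - i) i.
have cE i : c i = if b.[i] == (a.[i]).+1 then c i.+1 else l.[i] - a.[i].
  rewrite /c; case: (ltnP i N) => hi; last first.
    have -> : N - i = 0 by lia.
    rewrite /= (@nth_default _ _ b) ?(@nth_default _ _ a) ?(@nth_default _ _ l) //=;
      rewrite /N in hi; lia.
  by have -> : N - i = (N - i.+1).+1 by lia.
(* Downward induction on the row needs all three bounds: the carry is at most one cell, and [b.[i] -
   c i.+1], the candidate for [k.[i]], is not truncated and is at least [a.[i.+1]]. *)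
have c_le1 i : c i <= 1 /\ c i.+1 <= b.[i] /\ a.[i.+1] + c i.+1 <= b.[i].
  have [n le_n] := ubnP (N - i); elim: n i le_n => // n IH i le_n.
  case: (ltnP i N) => hi; last first.
    have z (j : nat) : N <= j -> c j = 0 by rewrite /c -subn_eq0 => /eqP->.
    by rewrite !z ?(leqW hi) // (@nth_default _ _ a) //; rewrite /N in hi; lia.
  have [|h1 [h2 h3]] := IH i.+1; first by lia.
  have := cE i; have := cE i.+1; have := al' i; have := bl' i.
  have := al' i.+1; have := bl' i.+1.
  have := part_geq pb (leqnSn i).
  by case: eqP => ?; try (case: eqP => ?); lia.
(* Where [b.[i] = a.[i] + 1] the two strips force [k.[i] = a.[i]]; elsewhere the outgoing carry is
   the excess of [b] over [k]. *)
pose g i := if b.[i] == (a.[i]).+1 then a.[i] else b.[i] - c i.+1.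
have ag i : a.[i.+1] <= g i <= a.[i].
  rewrite /g; have [h1 [h2 h3]] := c_le1 i; have := al' i; have := bl' i.
  by have := part_geq pa (leqnSn i); case: eqP; lia.
have gd i : g i.+1 <= g i by have := ag i; have := ag i.+1; lia.
have gN : g N = 0 by have := ag N; rewrite !(@nth_default _ _ a) // /N; lia.
pose k := part_of g N; have nk i : k.[i] = g i by rewrite nth_part_of.
have pk : is_part k by apply: part_of_part.
have ka : step true k a by split=> // i; rewrite nk.
have kb : step false k b.
  split=> // i; rewrite nk /g; have [h1 [h2 h3]] := c_le1 i; have [h4 _] := c_le1 i.+1.
  by case: eqP; lia.
have c01 : c 0 <= 1 by case: (c_le1 0).
exists k, (c 0); split=> //.
have ce i : carry k a b (c 0) i = c i.
  elim: i => //= i ->; rewrite nk /g; have := cE i; have [h1 [h2 h3]] := c_le1 i.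
  by case: eqP; lia.
have [[_ pr _] _ _] := rule_vh_sound ka kb c01.
apply: part_ext => // i; rewrite nth_rule_vh // ce.
by have := cE i; have := al' i; have := bl' i; case: eqP; lia.
Qed.

Lemma vh_rule : local_rule false true rule_vh.
Proof.
split; [exact: rule_vh_sound | | exact: rule_vh_surj].
by move=> a b k m k' m' ka kb m1 k'a k'b m'1; apply: rule_vh_inj.
Qed.

Definition growth (s t : bool) : seq nat -> seq nat -> seq nat -> nat -> seq nat :=
  match s, t with
  | true, true => rule_hh
  | false, false => rule_vv
  | false, true => rule_vh
  | true, false => fun k a b m => rule_vh k b a m
  end.

Lemma growth_rule s t : local_rule s t (growth s t).
Proof.
case: s t => [] []; [exact: hh_rule | exact: local_rule_sym vh_rule | | exact: vv_rule].
exact: vh_rule.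
Qed.

(** * Row insertion on chains of partitions *)

Local Notation top c := (head [::] c).

(* Chains of partitions are listed from the largest to the smallest partition,
   the initial empty partition being omitted. *)
Fixpoint chain (ss : seq bool) (c : seq (seq nat)) : Prop :=
  match ss, c with
  | [::], [::] => True
  | s :: ss', x :: c' => step s (top c') x /\ chain ss' c'
  | _, _ => False
  end.

Fixpoint weights (c : seq (seq nat)) : seq nat :=
  if c is x :: c' then sumn x - sumn (top c') :: weights c' else [::].

Fixpoint fits (t : bool) (ss : seq bool) (m : seq nat) : bool :=
  match ss, m with
  | [::], [::] => true
  | s :: ss', x :: m' => ((s != t) ==> (x <= 1)) && fits t ss' m'
  | _, _ => false
  end.

Fixpoint fits_rows (ts ss : seq bool) (M : seq (seq nat)) : bool :=
  match ts, M with
  | [::], [::] => true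
  | t :: ts', m :: M' => fits t ss m && fits_rows ts' ss M'
  | _, _ => false
  end.

(** One row of squares: [c] runs along its upper edge, the result along its lower edge. In the last
    square [k] is [top c'] and [a] is [top r]; the left edge is empty. *)
Fixpoint insert_row (t : bool) (ss : seq bool) (c : seq (seq nat)) (m : seq nat) :=
  match ss, c, m with
  | s :: ss', b :: c', x :: m' =>
      let r := insert_row t ss' c' m' in growth s t (top c') (top r) b x :: r
  | _, _, _ => [::]
  end.

(** The growth diagram with empty partitions along the top and left edges; the two chains are its
    bottom and right edges. As chains start from the largest partition, [M] starts with the last
    row. *)
Fixpoint insert_rows (ts ss : seq bool) (M : seq (seq nat)) :=
  match ts, M with
  | t :: ts', m :: M' =>
      let PQ := insert_rows ts' ss M' in
      let r := insert_row t ss PQ.1 m in (r, top r :: PQ.2)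
  | _, _ => (nseq (size ss) [::], [::])
  end.

Lemma step_sumn_le h p q : step h p q -> sumn p <= sumn q.
Proof.
move=> st; pose N := size p + size q.
rewrite (@sumn_nth p N) ?(@sumn_nth q N) ?leq_addl ?leq_addr //.
by apply: leq_sum => i _; apply: step_le st.
Qed.

Lemma insert_row_sound t ss c m : chain ss c -> fits t ss m ->
  [/\ chain ss (insert_row t ss c m),
      step t (top c) (top (insert_row t ss c m)),
      sumn (top (insert_row t ss c m)) = sumn (top c) + sumn m &
      forall i, (weights (insert_row t ss c m)).[i] = (weights c).[i] + m.[i]].
Proof.
elim: ss c m => [|s ss IH] [|b c] [|x m] //=.
  by move=> _ _; split=> //; [apply: step_refl | move=> i; rewrite nth_nil].
case=> cb cc /andP[hx hm]; have [h1 h2 h3 h4] := IH _ _ cc hm.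
have [L1 _ _] := growth_rule s t; have [s1 s2 e] := L1 _ _ _ _ h2 cb hx.
split=> //; first by lia.
case=> [|i] /=; last exact: h4.
by have := step_sumn_le s1; have := step_sumn_le cb; lia.
Qed.

(** Squares are undone from the right: [a], [b] and [l] of a square yield its [k], which is the
    corner [b] of the square to its left. *)
Lemma insert_row_inj t ss c m c' m' : chain ss c -> fits t ss m ->
  chain ss c' -> fits t ss m' -> top c = top c' ->
  insert_row t ss c m = insert_row t ss c' m' -> c = c' /\ m = m'.
Proof.
elim: ss c m c' m' => [|s ss IH] [|b c] [|x m] [|b' c'] [|x' m'] //=.
case=> cb cc /andP[hx hm] [cb' cc'] /andP[hx' hm'] eb [el er].
have [_ a _ _] := insert_row_sound cc hm; have [_ a' _ _] := insert_row_sound cc' hm'.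
have [_ L2 _] := growth_rule s t; rewrite -er -eb in a' cb' el.
have [ek ->] := L2 _ _ _ _ _ _ a cb hx a' cb' hx' el.
by have [-> ->] := IH _ _ _ _ cc hm cc' hm' ek er; rewrite eb.
Qed.

Lemma insert_row_surj t ss r b : chain ss r -> step t b (top r) ->
  exists c m, [/\ chain ss c, fits t ss m, top c = b & insert_row t ss c m = r].
Proof.
elim: ss r b => [|s ss IH] [|l r] b //=.
  by move=> _ /step_nil->; exists [::], [::].
case=> al cr bl; have [_ _ L3] := growth_rule s t.
have [k [x [ka kb hx e]]] := L3 _ _ _ al bl.
have [c [m [cc hm tc ec]]] := IH _ _ cr ka.
by exists (b :: c), (x :: m); split=> //=; rewrite ?hx ?tc // ec e.
Qed.

Lemma chain_nseq ss : chain ss (nseq (size ss) [::]).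
Proof. by elim: ss => //= s ss IH; split=> //; case: (ss) => *; apply: step_refl. Qed.

Lemma chain_top0 ss c : chain ss c -> top c = [::] -> c = nseq (size ss) [::].
Proof.
elim: ss c => [|s ss IH] [|x c] //= [st cc] ex; rewrite ex in st *.
by congr cons; apply: IH => //; apply: step_nil st.
Qed.

Lemma weights_nseq n i : (weights (nseq n [::])).[i] = 0.
Proof. by elim: n i => [|n IH] [|i] //=; case: (n). Qed.

Lemma insert_rows_sound ts ss M : fits_rows ts ss M ->
  let PQ := insert_rows ts ss M in
  [/\ chain ss PQ.1, chain ts PQ.2 & top PQ.1 = top PQ.2] /\
  (forall i, (weights PQ.1).[i] = \sum_(m <- M) m.[i]) /\
  (forall j, (weights PQ.2).[j] = sumn (nth [::] M j)).
Proof.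
elim: ts M => [|t ts IH] [|m M] //=.
  move=> _; split; first by split=> //; [apply: chain_nseq | case: (ss)].
  by split=> i; rewrite ?nth_nil // big_nil weights_nseq.
case/andP=> hm /IH[[c1 c2 tt] [w1 w2]].
have [h1 h2 h3 h4] := insert_row_sound c1 hm.
split; first by rewrite tt in h2.
split=> [i|]; first by rewrite h4 w1 big_cons addnC.
by case=> [|j] //=; rewrite h3 tt; lia.
Qed.

(** The second chain records the right edge, hence the upper right corner from which the last row
    can be undone; the other rows follow by induction. *)
Lemma insert_rows_inj ts ss M M' : fits_rows ts ss M -> fits_rows ts ss M' ->
  insert_rows ts ss M = insert_rows ts ss M' -> M = M'.
Proof.
elim: ts M M' => [|t ts IH] [|m M] [|m' M'] //= /andP[hm hM] /andP[hm' hM'] [er _ eQ].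
have [[c1 _ t1] _] := insert_rows_sound hM; have [[c1' _ t1'] _] := insert_rows_sound hM'.
have [| eP ->] := insert_row_inj c1 hm c1' hm' _ er; first by rewrite t1 t1' eQ.
by rewrite (IH M M') // [LHS]surjective_pairing eP eQ -surjective_pairing.
Qed.

Lemma insert_rows_surj ts ss P Q : chain ss P -> chain ts Q -> top P = top Q ->
  exists2 M, fits_rows ts ss M & insert_rows ts ss M = (P, Q).
Proof.
elim: ts P Q => [|t ts IH] P [|q Q] //=.
  by move=> cP _ tP; exists [::] => //; rewrite (chain_top0 cP).
move=> cP [st cQ] tP; rewrite -tP in st.
have [c [m [cc hm tc ec]]] := insert_row_surj cP st.
by have [M hM eM] := IH _ _ cc cQ tc; exists (m :: M); rewrite /= ?hm // eM ec tP.
Qed.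

(** * Extending rows by copies of one letter *)

(* A pair [(b, e)] stands for a row of length [b] that receives [e] new cells. *)
Definition demand (Z : seq (nat * nat)) (p : nat) : nat :=
  count (fun z => z.1 <= p < z.1 + z.2) Z.

(* The triple conditions between a lower row [z] and an upper row [w] that are
   extended by copies of one letter, with [h] telling whether it is primed. *)
Definition compat (h : bool) (z w : nat * nat) : bool :=
  if h then (z.1 == w.1) && (0 < z.2) ==> (0 < w.2)
  else [|| z.2 == 0, z.1 + z.2 <= w.1 | w.1 + w.2 < z.1].

Definition compatible (h : bool) (Z : seq (nat * nat)) : bool :=
  pairwise (compat h) Z && (h ==> all (fun z => z.2 <= 1) Z).

Lemma demand_rcons Z z p :
  demand (rcons Z z) p = demand Z p + (z.1 <= p < z.1 + z.2).
Proof. by rewrite /demand -cats1 count_cat /= addn0. Qed.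

Lemma demand_gt0 Z p :
  reflect (exists2 z, z \in Z & z.1 <= p < z.1 + z.2) (0 < demand Z p).
Proof. by rewrite -has_count; apply: hasP. Qed.

Lemma compatible_rcons h Z z : compatible h (rcons Z z) =
  [&& compatible h Z, all (compat h ^~ z) Z & h ==> (z.2 <= 1)].
Proof.
rewrite /compatible pairwise_rcons all_rcons; case: h => /=; rewrite ?andbT.
  by case: (_ <= 1); case: all; case: pairwise; rewrite ?andbF ?andbT.
by rewrite andbC.
Qed.

(** Two rows with a new cell in the same column would have overlapping runs. *)
Lemma demand_le1 Z p : compatible false Z -> demand Z p <= 1.
Proof.
elim/last_ind: Z => // Z z IH; rewrite compatible_rcons => /and3P[cZ /allP cz _].
rewrite demand_rcons; have := IH cZ; case: (posnP (demand Z p)) => [-> | ]; first by lia.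
by move=> /demand_gt0[w wZ hw]; have := cz w wZ; rewrite /compat; lia.
Qed.

Lemma count_gt_extended Z p :
  count (ltn p) [seq z.1 + z.2 | z <- Z] = count (ltn p) (unzip1 Z) + demand Z p.
Proof. by elim: Z => //= z Z ->; rewrite /demand /=; lia. Qed.

Lemma count_gt_extended_le1 Z p : all (fun z => z.2 <= 1) Z ->
  count (ltn p.+1) [seq z.1 + z.2 | z <- Z] <= count (ltn p) (unzip1 Z).
Proof. by elim: Z => //= z Z IH /andP[hz /IH]; lia. Qed.

(** The strict inequality in [compat] keeps lower rows from continuing the run of the top row, which
    thus exhausts the demanded columns from [a] on. *)
Lemma demand_last_run Z a e : compatible false (rcons Z (a, e)) ->
  demand (rcons Z (a, e)) (a + e) = 0.
Proof.
rewrite compatible_rcons => /and3P[_ /allP cz _]; apply/eqP; rewrite -leqn0 leqNgt.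
apply/negP => /demand_gt0[w]; rewrite mem_rcons inE => /orP[/eqP-> /=|]; first by lia.
by move/cz; rewrite /compat /=; lia.
Qed.

(** With at most one new cell per row, a demand in column [a] comes from rows of length [a], and
    [compat] serves the top one first. *)
Lemma demand_last_primed Z a e : compatible true (rcons Z (a, e)) ->
  e = (0 < demand (rcons Z (a, e)) a) :> nat.
Proof.
rewrite compatible_rcons => /and3P[cZ /allP cz /= e1].
have /andP[_ /allP Z1] := cZ; rewrite demand_rcons /=.
case: e e1 cz => [|[|//]] _ cz; last by lia.
have : ~ 0 < demand Z a; last by lia.
by move=> /demand_gt0[w wZ hw]; have := Z1 _ wZ; have := cz _ wZ; rewrite /compat /=; lia.
Qed.

(** For either kind of letter the demand forces the share of the top row; removing it leaves the
    same problem for the lower rows. *)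
Lemma demand_inj h Z Z' : unzip1 Z = unzip1 Z' -> compatible h Z -> compatible h Z' ->
  (forall p, demand Z p = demand Z' p) -> Z = Z'.
Proof.
elim/last_ind: Z Z' => [|Z [a e] IH] Z'; first by case: Z'.
case/lastP: Z' => [|Z' [a' e']]; first by move/(congr1 size); rewrite /= !size_map size_rcons.
rewrite /unzip1 !map_rcons => /rcons_inj[eZ /= <-] cZ cZ' eD.
have ee : e = e'.
  case: h {IH} cZ cZ' => cZ cZ'.
    by rewrite (demand_last_primed cZ) (demand_last_primed cZ') eD.
  have h1 := demand_last_run cZ; have h2 := demand_last_run cZ'.
  have := eD (a + e'); have := eD (a + e); rewrite h1 h2 !demand_rcons /=; lia.
rewrite -{e'}ee in cZ' eD *; congr rcons; apply: (IH _ eZ).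
- by move: cZ; rewrite compatible_rcons => /andP[].
- by move: cZ'; rewrite compatible_rcons => /andP[].
by move=> p; have := eD p; rewrite !demand_rcons => /addIn.
Qed.

(** A primed cell in column [p] needs a row of length [p] of its own; for an unprimed letter every
    maximal run of demanded columns must start where some row ends. *)
Definition satisfiable (h : bool) (D : nat -> nat) (R : seq nat) : Prop :=
  if h then forall p, D p <= count_mem p R
  else (forall p, D p <= 1) /\
       (forall p, 0 < D p -> p = 0 \/ D p.-1 = 0 -> p \in R).

(* Greedy construction from the top row: a row of length [a] takes one cell in
   the primed case and the maximal run of demanded positions from [a] otherwise. *)
Lemma demand_surj h D R B : (forall p, B <= p -> D p = 0) -> satisfiable h D R ->
  exists Z, [/\ unzip1 Z = R, compatible h Z & forall p, demand Z p = D p].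
Proof.
elim/last_ind: R D => [|R a IH] D DB sD.
  exists [::]; split=> //; first by rewrite /compatible implybT.
  move=> p; symmetry; case: h sD => [/(_ p)|[_ sD]]; first by rewrite leqn0 => /eqP.
  elim: p => [|p IHp]; apply/eqP; rewrite -leqn0 leqNgt; apply/negP => /sD.
    by rewrite in_nil => /(_ (or_introl erefl)).
  by rewrite in_nil => /(_ (or_intror IHp)).
case: h IH sD => [IH sD | IH [D1 sD]].
  pose D' p := D p - (p == a).
  have [|p|Z [uZ cZ dZ]] := IH D'; first by move=> p /DB; rewrite /D' => ->.
    by have := sD p; rewrite -cats1 count_cat /= addn0 /D' eq_sym; lia.
  exists (rcons Z (a, (0 < D a) : nat)); split.
  - by rewrite -uZ [LHS]map_rcons.
  - rewrite compatible_rcons cZ /= leq_b1 andbT; apply/allP => z zZ; rewrite /compat /=.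
    apply/implyP => /andP[/eqP ez hz]; have : 0 < demand Z a.
      by apply/demand_gt0; exists z; rewrite // ez; lia.
    by rewrite dZ /D' eqxx; lia.
  by move=> p; rewrite demand_rcons dZ /D' /=; case: (eqVneq p a) => [->|]; lia.
have [|e /eqP e0 emin] := ex_minnP (P := fun e => D (a + e) == 0).
  by exists B; rewrite DB ?leq_addl.
have run p : a <= p < a + e -> 0 < D p.
  move=> hp; rewrite lt0n; apply/negP => hD; have := emin (p - a).
  by rewrite subnKC ?hD; [move/(_ isT) | ]; lia.
pose D' p := if a <= p < a + e then 0 else D p.
have [||Z [uZ cZ dZ]] := IH D'; first by move=> p /DB; rewrite /D' => ->; rewrite if_same.
  split=> p; first by rewrite /D'; case: ifP.
  rewrite /D'; case: ifP => // hp Dp hp'.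
  (* Erasing the run creates no new run start: only [a + e] could become one, and it is not
     demanded. *)
  have [ep | ep] := eqVneq p (a + e); first by rewrite ep e0 in Dp.
  have {}hp' : p = 0 \/ D p.-1 = 0.
    by case: hp' => [->|]; [left | case: ifP => [? _|]; [lia | right]].
  have := sD p Dp hp'; rewrite mem_rcons inE => /orP[/eqP epa|//].
  have e00 : e = 0 by lia.
  by rewrite epa in Dp; rewrite e00 addn0 in e0; rewrite e0 in Dp.
exists (rcons Z (a, e)); split.
- by rewrite -uZ [LHS]map_rcons.
- rewrite compatible_rcons cZ /= andbT; apply/allP => -[b f] zZ; rewrite /compat /=.
  (* A conflicting lower row would get a cell in column [maxn a b], which lies in the erased run or
     at its end [a + e], where no demand is left. *)
  apply: contraT => hz; have : 0 < demand Z (maxn a b).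
    by apply/demand_gt0; exists (b, f) => //=; lia.
  rewrite dZ /D'; case: ifP => // h1 h2.
  by have e1 : maxn a b = a + e; [lia | rewrite e1 e0 in h2].
move=> p; rewrite demand_rcons dZ /D' /=; case: ifP => hp; last by rewrite addn0.
by have := run p hp; have := D1 p; lia.
Qed.

(** * Tableaux over the natural numbers *)

(* Weak below [k] and strict from [k] on, as along rows; the reversed negation
   [~~ row_ok k y x] is then the order strict below [k] and weak from [k] on
   that governs the first column and the conclusions of both triple conditions. *)
Definition row_ok (k : nat) : rel nat := fun x y => x + (k <= x) <= y.

(** Here [s] is the lower row. The leftmost column comes first, then both triple conditions at once;
    the bounds on [size u] replace the infinite entries of missing cells. *)
Definition rows_ok (k : nat) : rel (seq nat) := fun s u =>
  ~~ row_ok k u.[0] s.[0] &&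
  all (fun p => (p.-1 < size u) && row_ok k u.[p.-1] s.[p] ==>
                (p < size u) && ~~ row_ok k s.[p] u.[p])
      (iota 1 (size s).-1).

Definition tableau (k : nat) (F : seq (seq nat)) : bool :=
  [&& [::] \notin F, all (sorted (row_ok k)) F & pairwise (rows_ok k) F].

Lemma rows_okP k s u : reflect (~~ row_ok k u.[0] s.[0] /\
    forall p, 0 < p < size s -> p.-1 < size u -> row_ok k u.[p.-1] s.[p] ->
      p < size u /\ ~~ row_ok k s.[p] u.[p])
  (rows_ok k s u).
Proof.
apply: (iffP andP) => -[h0 h]; split=> //.
  move=> p hp h1 h2; move/allP: h => /(_ p); rewrite mem_iota h1 h2 /=.
  by case/(_ _)/andP=> //; lia.
apply/allP => p; rewrite mem_iota => hp; apply/implyP => /andP[h1 h2].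
by apply/andP; apply: h => //; lia.
Qed.

Lemma row_ok_trans k : transitive (row_ok k).
Proof. by move=> y x z; rewrite /row_ok; lia. Qed.

(** * Appending copies of the largest letter *)

Definition extend (t : nat) (w : seq nat * nat) : seq nat := w.1 ++ nseq w.2 t.

Lemma nth_extend t w p : p < size w.1 + w.2 ->
  (extend t w).[p] = if p < size w.1 then (w.1).[p] else t.
Proof. by move=> hp; rewrite nth_cat nth_nseq; case: ifP => //; case: ifP => //; lia. Qed.

Lemma size_extend t w : size (extend t w) = size w.1 + w.2.
Proof. by rewrite size_cat size_nseq. Qed.

Definition cells (w : seq nat * nat) : nat * nat := (size w.1, w.2).

Definition extensible (k t : nat) (w : seq nat * nat) : bool :=
  [&& all (gtn t) w.1, nilp w.1 ==> (0 < w.2) & (k <= t) ==> (w.2 <= 1)].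

Lemma extensible_lt k t w p : extensible k t w -> p < size w.1 -> (w.1).[p] < t.
Proof. by case/and3P=> /allP ht _ _ hp; apply: ht; apply: mem_nth. Qed.

(** Against a smaller letter of the lower row, an appended [t] in the upper row acts like a missing
    cell. What remains are the columns [p] where the lower row has [t]. If [t] is unprimed, the
    upper row must have an old cell there or none in column [p.-1]; if primed, it must not end just
    before [p]. *)
Lemma rows_ok_extend k t w v : extensible k t w -> extensible k t v ->
  (nilp w.1 ==> nilp v.1) ->
  rows_ok k (extend t w) (extend t v) =
    (~~ nilp v.1 ==> rows_ok k w.1 v.1) && compat (k <= t) (cells w) (cells v).
Proof.
move=> ew ev; have lw := @extensible_lt _ _ _ _ ew; have lv := @extensible_lt _ _ _ _ ev.
move/and3P: ew => [_ w0 w1]; move/and3P: ev => [_ v0 v1].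
case: w v => [s e] [u f] /= in lw lv w0 w1 v0 v1 *; rewrite /nilp in w0 v0 * => su.
have nS p : p < size s + e -> (extend t (s, e)).[p] = if p < size s then s.[p] else t.
  exact: (@nth_extend t (s, e)).
have nU p : p < size u + f -> (extend t (u, f)).[p] = if p < size u then u.[p] else t.
  exact: (@nth_extend t (u, f)).
have S0 : 0 < size s + e by lia.
have U0 : 0 < size u + f by lia.
apply/rows_okP/andP; rewrite !size_extend /= => -[h0 h].
  rewrite nS // nU // in h0.
  split.
    apply/implyP => un; apply/rows_okP.
    have [us ss] : 0 < size u /\ 0 < size s by lia.
    rewrite us ss in h0; split=> // p hp hq hr.
    have e1 : (extend t (s, e)).[p] = s.[p] by rewrite nS; case: ltnP; lia.
    have e2 : (extend t (u, f)).[p.-1] = u.[p.-1] by rewrite nU; case: ltnP; lia.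
    have [|||hp' hc] := h p; rewrite ?e1 ?e2 //; try lia.
    move: hc; rewrite e1 nU //; case: ltnP => // _.
    by have := lw p; rewrite /row_ok; lia.
  rewrite /compat /cells /=; case: ifP => kt.
    apply/implyP => /andP[/eqP es he].
    have [s00|s_gt0] := posnP (size s); first by lia.
    have [|||] // := h (size s); try lia.
    rewrite nS ?nU; try lia; rewrite ltnn.
    by have -> : (size s).-1 < size u; [lia | have := lv (size s).-1; rewrite /row_ok; lia].
  (* For conflicting runs the lower row has [t] in column [p], while the upper row has a cell in
     column [p.-1] but no smaller letter in column [p]. For [p = 0] the leftmost column is
     violated. *)
  apply: contraT => hc; pose p := maxn (size s) (size u).
  have [p0|p_gt0] := posnP p.
    by move: h0; rewrite /row_ok; do 2 case: ltnP; lia.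
  have e1 : (extend t (s, e)).[p] = t by rewrite nS; [case: ltnP; lia | lia].
  have [|||hp'] := h p; rewrite ?e1; try lia.
    rewrite nU; last by lia.
    by have := lv p.-1; rewrite /row_ok; case: ifP; lia.
  by rewrite nU //; case: ltnP; rewrite /row_ok; lia.
split.
  rewrite nS // nU //; have := lw 0; have := lv 0; move: h; rewrite /compat /cells /= /row_ok.
  have [u0|u_gt0] := posnP (size u); last first.
    have s_gt0 : 0 < size s by lia.
    move: h0; rewrite -lt0n u_gt0 s_gt0 /= => /rows_okP[h0 _] _ _ _; exact: h0.
  by case: ifP => //; case: ifP; lia.
move=> p hp hq; have pu : p.-1 < size u + f by lia.
rewrite nS ?(nU p.-1) //; last by lia.
have := lw p; have := lv p; have := lv p.-1.
case: (ltnP p.-1 (size u)) => hu; last first.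
  by move: h; rewrite /compat /cells /= /row_ok; case: ifP; case: (ltnP p (size s)); lia.
case: (ltnP p (size s)) => hs.
  move: h0; have -> /= : size u != 0 by lia.
  case/rows_okP=> _ /(_ p) h0 _ _ _ hr; have [|||h1 h2] := h0; rewrite ?nU ?h1 //; lia.
move=> h1 h2 h3 hr; have pf : p < size u + f.
  by move: h hr; rewrite /compat /cells /= /row_ok; case: ifP; lia.
split=> //; rewrite nU //; move: h hr; rewrite /compat /cells /= /row_ok.
by case: (ltnP p (size u)); case: ifP; lia.
Qed.

Lemma sorted_extend k t w : extensible k t w ->
  sorted (row_ok k) (extend t w) = sorted (row_ok k) w.1.
Proof.
case/and3P=> /allP ht _ w1; have tr := @row_ok_trans k.
rewrite !sorted_pairwise // pairwise_cat.
have -> : allrel (row_ok k) w.1 (nseq w.2 t).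
  apply/allrelP => x y /ht /=; rewrite mem_nseq => xt /andP[_ /eqP->].
  by rewrite /row_ok; lia.
have -> : pairwise (row_ok k) (nseq w.2 t); last by rewrite andbT.
move: w1; case: leqP => kt /=; first by case: (w.2) => [|[|]].
by move=> _; elim: (w.2) => //= e ->; rewrite all_nseq /row_ok andbT; lia.
Qed.

Definition extension (k t : nat) (W : seq (seq nat * nat)) : bool :=
  all (extensible k t) W && pairwise (fun w v => nilp w.1 ==> nilp v.1) W.

Definition base (W : seq (seq nat * nat)) : seq (seq nat) :=
  [seq s <- unzip1 W | ~~ nilp s].

(** The conditions involving the largest letter depend on row lengths alone, so they separate from
    those on the smaller letters. *)
Lemma tableau_extend k t W : extension k t W ->
  tableau k (map (extend t) W) = tableau k (base W) && compatible (k <= t) (map cells W).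
Proof.
rewrite /tableau /compatible => /andP[].
have -> : [::] \notin base W by rewrite mem_filter.
elim: W => [|w W IH] /=; first by rewrite implybT.
case/andP=> ew eW /andP[nW pW]; move: (IH eW pW).
rewrite inE negb_or; have -> /= : [::] != extend t w.
  rewrite eq_sym -size_eq0 size_extend; have /and3P[_ w0 _] := ew.
  by rewrite /nilp in w0; lia.
have e1 : all (rows_ok k (extend t w)) (map (extend t) W) =
    (~~ nilp w.1 ==> all (rows_ok k w.1) (base W)) &&
    all (compat (k <= t) (cells w)) (map cells W).
  rewrite !all_map /base all_filter all_map.
  case: (boolP (nilp w.1)) nW => /= nw nW.
    apply: eq_in_all => v vW /=; rewrite (rows_ok_extend ew) ?(allP eW) ?nw //=.
      by have := allP nW v vW; rewrite /= => ->.
    by have := allP nW v vW.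
  rewrite -all_predI; apply: eq_in_all => v vW /=.
  by rewrite (rows_ok_extend ew) ?(allP eW) //= (negbTE nw).
rewrite {}e1 sorted_extend //.
have e2 : (k <= t) ==> ((cells w).2 <= 1) by case/and3P: ew.
have e3 (x : bool) : ((k <= t) ==> ((cells w).2 <= 1) && x) = ((k <= t) ==> x).
  by move: e2; case: (k <= t); case: (_ <= 1).
rewrite e3; have -> : base (w :: W) = if nilp w.1 then base W else w.1 :: base W.
  by rewrite /base /=; case: (nilp _).
case: (boolP (nilp w.1)) => nw /=.
  have -> : sorted (row_ok k) w.1 by case: (w.1) nw.
  by case: (all (compat _ _) _) => //=; rewrite !andbF.
case: (all (rows_ok k w.1) _); last by rewrite !andbF.
case: (all (compat _ _) _); last by rewrite !andbF.
case: (sorted (row_ok k) w.1) => //=; by rewrite !andbF.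
Qed.

Lemma unzip1_extension k t W : extension k t W ->
  unzip1 W = base W ++ nseq (size W - size (base W)) [::].
Proof.
case/andP=> _; elim: W => //= w W IH /andP[hw /IH e]; rewrite /base /=.
case: (boolP (nilp w.1)) hw => /= nw hw; last by rewrite subSS {1}e.
have b0 : base W = [::].
  rewrite /base; apply/eqP; rewrite -[_ == _]negbK -has_filter has_map -all_predC.
  by apply: sub_all hw => v /= ->.
move: e; rewrite -/(base W) b0 /= subn0 => {1}->.
by case: (w.1) nw.
Qed.

(** * Removing the largest letter *)

Definition strip (t : nat) (F : seq (seq nat)) : seq (seq nat * nat) :=
  [seq ([seq x <- s | x < t], count_mem t s) | s <- F].

Definition restrict (t : nat) (F : seq (seq nat)) : seq (seq nat) :=
  [seq s <- [seq [seq x <- s | x < t] | s <- F] | ~~ nilp s].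

Definition bounded (n : nat) (F : seq (seq nat)) : bool := all (all (gtn n)) F.

Lemma base_strip t F : base (strip t F) = restrict t F.
Proof. by rewrite /base /strip /unzip1 -map_comp. Qed.

Lemma extend_strip_row k t s : sorted (row_ok k) s -> all (gtn t.+1) s ->
  [seq x <- s | x < t] ++ nseq (count_mem t s) t = s.
Proof.
elim: s => //= x s IH sx /andP[xt st].
have := IH (path_sorted sx) st; case: (ltnP x t) => hx e; last first.
  have ex : x = t by lia.
  have h y : y \in s -> y = t.
    move=> ys; have := allP (order_path_min (@row_ok_trans k) sx) y ys.
    by have := allP st y ys; rewrite /= /row_ok; lia.
  have -> : [seq x0 <- s | x0 < t] = [::].
    apply/eqP; rewrite -[_ == _]negbK -has_filter; apply/negP => /hasP[y /h->].
    by rewrite ltnn.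
  have /all_pred1P es : all (pred1 t) s by apply/allP => y /h /= ->.
  by rewrite ex eqxx {2}es es count_nseq /= eqxx mul1n size_nseq.
by have -> : (x == t) = false by [lia]; rewrite /= e.
Qed.

Lemma tableau_strip k t F : tableau k F -> bounded t.+1 F ->
  map (extend t) (strip t F) = F /\ extension k t (strip t F).
Proof.
case/and3P=> F0 /allP sF pF /allP bF.
have eF : map (extend t) (strip t F) = F.
  rewrite -map_comp -[RHS]map_id; apply/eq_in_map => s sinF.
  by apply: (@extend_strip_row k); [apply: sF | apply: bF].
split=> //; apply/andP; split.
  apply/allP => w /mapP[s sinF ->]; apply/and3P; split => /=.
  - by apply/allP => x; rewrite mem_filter => /andP[].
  - apply/implyP => /nilP e; have := extend_strip_row (sF _ sinF) (bF _ sinF).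
    rewrite e; case: (count_mem t s) => //= s0.
    by move: F0; rewrite s0 sinF.
  apply/implyP => kt; have := sF _ sinF.
  rewrite -{1}(extend_strip_row (sF _ sinF) (bF _ sinF)).
  move/(subseq_sorted (@row_ok_trans k) (suffix_subseq _ _)).
  by case: (count_mem t s) => [|[|e]] //=; rewrite /row_ok kt; lia.
(* By the leftmost column, a row starting with [t] has only rows starting with [t] above it. *)
rewrite pairwise_map; apply: sub_in_pairwise (allss F) pF => s u sinF uinF /rows_okP[h _].
have s0 : s != [::] by apply: contraNneq F0 => <-.
have u0 : u != [::] by apply: contraNneq F0 => <-.
apply/implyP => /= /nilP es; rewrite /nilp size_eq0; apply: contraNT h.
case: s s0 sinF es => // x s _ /bF /= /andP[xt _]; case: ifP => // hx _.
case: u u0 uinF => // y u _ uinF; move: (sF _ uinF) => /= py; case: ifP => hy.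
  by rewrite /= /row_ok; lia.
have /= := allP (order_path_min (@row_ok_trans k) py).
move=> h hn; exfalso; move: hn; rewrite -has_filter => /hasP[z /h]; rewrite /row_ok; lia.
Qed.

Lemma shape_extend t W :
  shape (map (extend t) W) = [seq z.1 + z.2 | z <- map cells W].
Proof. by rewrite /shape -!map_comp; apply: eq_map => w /=; rewrite size_extend. Qed.

Lemma unzip1_cells W : unzip1 (map cells W) = shape (unzip1 W).
Proof. by rewrite /shape /unzip1 -!map_comp. Qed.

Lemma count_gt_cells k t W p : extension k t W ->
  count (ltn p) (shape (map (extend t) W)) =
  count (ltn p) (shape (base W)) + demand (map cells W) p.
Proof.
move=> eW; rewrite shape_extend count_gt_extended unzip1_cells (unzip1_extension eW).
by rewrite /shape map_cat map_nseq count_cat count_nseq /= addn0.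
Qed.

(** An unprimed letter gives no column two cells. A primed one gives no row two cells, so a row
    longer than [p.+1] afterwards was longer than [p] before. *)
Lemma extension_step k t W : extension k t W -> tableau k (map (extend t) W) ->
  step (k <= t) (conjugate (shape (base W))) (conjugate (shape (map (extend t) W))).
Proof.
move=> eW tW; split; try exact: conj_part.
move: (tW); rewrite (tableau_extend eW) => /andP[_ cW].
case: (boolP (k <= t)) cW => kt cW p; rewrite !nth_conj; last first.
  by rewrite (count_gt_cells _ eW); have := demand_le1 p cW; lia.
rewrite (count_gt_cells p eW) leq_addr andbT shape_extend.
have /andP[_ Z1] := cW; apply: leq_trans (count_gt_extended_le1 p Z1) _.
rewrite unzip1_cells (unzip1_extension eW) /shape map_cat map_nseq count_cat count_nseq.
by rewrite /= addn0.
Qed.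

(* The letters below [n] in decreasing order; [true] marks the primed ones. *)
Fixpoint letter_types (k n : nat) : seq bool :=
  if n is m.+1 then (k <= m) :: letter_types k m else [::].

Fixpoint tableau_chain (n : nat) (F : seq (seq nat)) : seq (seq nat) :=
  if n is m.+1 then conjugate (shape F) :: tableau_chain m (restrict m F) else [::].

Lemma tableau_bounded0 k F : tableau k F -> bounded 0 F -> F = [::].
Proof. by case: F => [|[|x s] F] //=; rewrite /tableau in_cons. Qed.

Lemma bounded_flatten n F : bounded n F = all (gtn n) (flatten F).
Proof. by elim: F => //= s F IH; rewrite all_cat -IH. Qed.

Lemma bounded_restrict n F : bounded n (restrict n F).
Proof.
apply/allP => s; rewrite mem_filter => /andP[_ /mapP[u _ ->]].
by apply/allP => x; rewrite mem_filter => /andP[].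
Qed.

Lemma tableau_restrict k t F : tableau k F -> bounded t.+1 F -> tableau k (restrict t F).
Proof.
move=> tF bF; have [eF xF] := tableau_strip tF bF.
by move: tF; rewrite -{1}eF (tableau_extend xF) base_strip => /andP[].
Qed.

Lemma top_tableau_chain k n F : tableau k F -> bounded n F ->
  top (tableau_chain n F) = conjugate (shape F).
Proof. by case: n => //= tF /(tableau_bounded0 tF) ->. Qed.

Lemma tableau_chainP k n F : tableau k F -> bounded n F ->
  chain (letter_types k n) (tableau_chain n F).
Proof.
elim: n F => //= n IH F tF bF; have tF' := tableau_restrict tF bF.
split; last by apply: IH => //; apply: bounded_restrict.
rewrite (top_tableau_chain tF') ?bounded_restrict //.
have [eF xF] := tableau_strip tF bF; rewrite -{2}eF -base_strip.
by apply: extension_step => //; rewrite eF.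
Qed.

Lemma count_flatten_restrict t F (P : pred nat) :
  count P (flatten (restrict t F)) = count (predI P (gtn t)) (flatten F).
Proof.
rewrite /restrict; elim: F => //= s F IH; rewrite count_cat -IH -count_filter.
by case: (boolP (nilp _)) => [/nilP-> //| _]; rewrite /= count_cat.
Qed.

(** Consecutive sizes differ by the number of copies of the largest remaining letter; the index is
    reversed because the chain starts with the largest letter. *)
Lemma weights_tableau_chain k n F i : tableau k F -> bounded n F -> i < n ->
  (weights (tableau_chain n F)).[i] = count_mem (n - i.+1) (flatten F).
Proof.
elim: n F i => // n IH F i tF bF; have tF' := tableau_restrict tF bF.
case: i => [_|i lt_i] /=.
  rewrite (top_tableau_chain tF') ?bounded_restrict // !sumn_conj -!size_flatten subSS subn0.
  rewrite -(count_predT (flatten (restrict _ _))) count_flatten_restrict.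
  have : all (gtn n.+1) (flatten F) by rewrite -bounded_flatten.
  elim: (flatten F) => //= x s IHs /andP[hx /IHs <-].
  have : count (predI predT (gtn n)) s <= size s by apply: count_size.
  by case: (ltngtP x n) hx => //= h; lia.
rewrite (IH _ i tF') ?bounded_restrict // count_flatten_restrict subSS.
by apply: eq_count => x; rewrite /predI /= ?inE /=; case: eqP => //= ->; lia.
Qed.

(** A row gets a new cell in column 0 exactly when it was empty before. *)
Lemma size_base_count W k t : extension k t W ->
  demand (map cells W) 0 = size W - size (base W).
Proof.
move=> eW; have := count_gt_cells 0 eW.
have full F : [::] \notin F -> count (ltn 0) (shape F) = size F.
  elim: F => //= s F IH; rewrite in_cons negb_or => /andP[s0 /IH->].
  by case: s s0.
rewrite !full; first by rewrite size_map => ->; rewrite addKn.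
  by rewrite mem_filter.
apply/mapP => -[w wW e]; have /andP[/allP /(_ w wW) /and3P[_ w0 _] _] := eW.
have := congr1 size e; rewrite size_extend /=; move: w0; rewrite /nilp; lia.
Qed.

(** By induction the chain fixes the tableau without its largest letter; the two largest partitions
    fix the demand, and the demand fixes its distribution over the rows. *)
Lemma tableau_chain_inj k n F F' : tableau k F -> bounded n F ->
  tableau k F' -> bounded n F' -> tableau_chain n F = tableau_chain n F' -> F = F'.
Proof.
elim: n F F' => [|n IH] F F' tF bF tF' bF'.
  by rewrite (tableau_bounded0 tF bF) (tableau_bounded0 tF' bF').
case=> e0 /IH eR; have {}eR := eR (tableau_restrict tF bF) (bounded_restrict _ _)
  (tableau_restrict tF' bF') (bounded_restrict _ _).
have [eF xF] := tableau_strip tF bF; have [eF' xF'] := tableau_strip tF' bF'.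
rewrite -eF -eF'; congr map.
have eD p : demand (map cells (strip n F)) p = demand (map cells (strip n F')) p.
  have h1 := count_gt_cells p xF; have h2 := count_gt_cells p xF'.
  rewrite -!nth_conj eF eF' !base_strip eR e0 in h1 h2.
  by apply: (@addnI (conjugate (shape (restrict n F'))).[p]); rewrite -h1 -h2.
have eU : unzip1 (strip n F) = unzip1 (strip n F').
  rewrite (unzip1_extension xF) (unzip1_extension xF').
  by rewrite -!(size_base_count xF, size_base_count xF') eD !base_strip eR.
have eC : map cells (strip n F) = map cells (strip n F').
  move: tF tF'; rewrite -{1}eF -{1}eF' (tableau_extend xF) (tableau_extend xF').
  move=> /andP[_ cF] /andP[_ cF']; apply: demand_inj cF cF' eD.
  by rewrite !unzip1_cells eU.
have e2 : unzip2 (strip n F) = unzip2 (strip n F').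
  have h W : unzip2 W = unzip2 (map cells W) by rewrite /unzip2 -map_comp.
  by rewrite !h eC.
by rewrite -(zip_unzip (strip n F)) eU e2 zip_unzip.
Qed.

Lemma map_cells_zip A B : map cells (zip A B) = zip (shape A) B.
Proof. by elim: A B => [|a A IH] [|b B] //=; rewrite IH. Qed.

(** Ensures that no row added for the cells of column 0 stays empty. *)
Lemma demand0_full Z z : demand Z 0 = count_mem 0 (unzip1 Z) -> z \in Z ->
  z.1 = 0 -> 0 < z.2.
Proof.
have le Y : demand Y 0 <= count_mem 0 (unzip1 Y).
  rewrite /demand /unzip1 count_map; apply: sub_count => y /=.
  by rewrite leqn0 => /andP[].
elim: Z => //= y Z IH e; rewrite in_cons => /orP[/eqP->|zZ] z0.
  by move: e (le Z); rewrite /demand /= z0; lia.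
by apply: IH => //; move: e (le Z); rewrite /demand /=; case: (y) => [[|u] v] /=; lia.
Qed.

Lemma restrict_extend k t W : extension k t W -> restrict t (map (extend t) W) = base W.
Proof.
case/andP=> /allP xW _; rewrite /restrict /base -map_comp; congr filter.
apply/eq_in_map => w /xW /and3P[/all_filterP h _ _] /=; rewrite filter_cat h.
rewrite [X in _ ++ X](_ : _ = [::]) ?cats0 //.
by elim: (w.2) => //= m; rewrite ltnn.
Qed.

Lemma tableau_chain_surj k n c : chain (letter_types k n) c ->
  exists F, [/\ tableau k F, bounded n F & tableau_chain n F = c].
Proof.
elim: n c => [|n IH] [|x c] //=; first by exists [::].
case=> st /IH[F0 [t0 b0 ec]].
rewrite -ec (top_tableau_chain t0 b0) in st.
have [_ px st'] := st.
pose D p := x.[p] - (conjugate (shape F0)).[p].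
have xD p : x.[p] = count (ltn p) (shape F0) + D p.
  by rewrite /D -nth_conj; have := step_le p st; lia.
(* The [D 0] empty rows on top are to receive the cells of column 0. *)
pose R := shape F0 ++ nseq (D 0) 0.
have F0n : [::] \notin F0 by case/and3P: t0.
have F0s s : s \in F0 -> 0 < size s by case: s => // s0; rewrite s0 in F0n.
have cnt p : count (ltn p) (shape F0) = count_mem p.+1 (shape F0) + count (ltn p.+1) (shape F0).
  elim: (shape F0) => //= y S ->; case: (ltngtP y p.+1) => h; lia.
have mem0 : count_mem 0 R = D 0.
  rewrite count_cat count_nseq mul1n (count_memPn _) //.
  by apply/mapP => -[s /F0s h e]; rewrite -e in h.
have memS p : count_mem p.+1 R = count_mem p.+1 (shape F0).
  by rewrite count_cat count_nseq addn0.
(* Primed: interlacing bounds [D p.+1] by the number of rows of length [p.+1]. Unprimed: if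
   [D p = 0 < D p.+1], then [x.[p.+1] <= x.[p]] forces the old columns [p] and [p.+1] to differ, so
   some row has length [p.+1]. *)
have sat : satisfiable (k <= n) D R.
  rewrite /satisfiable; case: (k <= n) st' => st'.
    move=> [|p]; first by rewrite mem0.
    rewrite memS leq_subLR !nth_conj addnC -cnt.
    by have := st' p; rewrite nth_conj => /andP[].
  split=> p; first by have := st' p; rewrite /D; lia.
  move=> Dp h; rewrite -has_pred1 has_count.
  case: p Dp h => [|p] Dp h; first by rewrite mem0.
  case: h => // h; rewrite memS; have := xD p.+1; have := xD p; rewrite h (cnt p).
  by have := part_geq px (leqnSn p); lia.
have DB p : size x <= p -> D p = 0 by move=> h; rewrite /D nth_default.
have [Z [uZ cZ dZ]] := demand_surj DB sat.
have sZ : size Z = size F0 + D 0 by rewrite -(size_map fst) -/(unzip1 Z) uZ size_cat size_map size_nseq.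
pose W := zip (F0 ++ nseq (D 0) [::]) (unzip2 Z).
have sW : size (F0 ++ nseq (D 0) [::]) = size (unzip2 Z).
  by rewrite size_map sZ size_cat size_nseq.
have cW : map cells W = Z by rewrite /W map_cells_zip /shape map_cat map_nseq -/(shape F0) -/R -uZ zip_unzip.
have uW : unzip1 W = F0 ++ nseq (D 0) [::] by rewrite unzip1_zip ?sW.
have bW : base W = F0.
  rewrite /base uW filter_cat; have -> : [seq s <- nseq (D 0) [::] | ~~ nilp s] = [::] :> seq (seq nat).
    by elim: (D 0).
  by rewrite cats0; apply/all_filterP/allP => s /F0s; case: (s).
have xW : extension k n W.
  apply/andP; split; last first.
    rewrite -(pairwise_map fst (fun s u => nilp s ==> nilp u)) -/(unzip1 W) uW pairwise_cat.
    apply/and3P; split.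
    - by apply/allrelP => s u _ /nseqP[-> _]; rewrite implybT.
    - by apply/(pairwiseP [::]) => i j hi _ _; have := F0s _ (mem_nth [::] hi); case: nth.
    by elim: (D 0) => //= m ->; rewrite all_nseq orbT.
  apply/allP => w wW; have wZ : cells w \in Z by rewrite -cW map_f.
  apply/and3P; split.
  - have : w.1 \in unzip1 W by apply: map_f.
    rewrite uW mem_cat => /orP[/(allP b0) // | /nseqP[-> _] //].
  - apply/implyP => /nilP w0; apply: (demand0_full _ wZ); last by rewrite /= w0.
    by rewrite dZ uZ mem0.
  by apply/implyP => kn; have /andP[_ /implyP/(_ kn)/allP/(_ _ wZ)] := cZ.
exists (map (extend n) W); rewrite tableau_extend // bW t0 cW cZ; split=> //.
  apply/allP => _ /mapP[w wW ->]; rewrite all_cat all_nseq /= ltnS leqnn orbT andbT.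
  have /andP[/allP/(_ w wW)/and3P[h _ _] _] := xW.
  by apply: sub_all h => y /= /ltnW.
congr cons; last by rewrite (restrict_extend xW) bW.
apply: part_ext => //; first exact: conj_part.
by move=> p; rewrite nth_conj (count_gt_cells p xW) bW cW dZ xD.
Qed.

(** * Hook composition tableaux and matrices *)

Lemma pairwise_filter (T : Type) (r : rel T) (P : pred T) s :
  pairwise r [seq x <- s | P x] = pairwise (fun x y => P x && P y ==> r x y) s.
Proof.
elim: s => //= x s IH; case: (boolP (P x)) => Px /=; rewrite IH ?all_filter //.
by rewrite all_predT.
Qed.

(** For transitive relations sortedness is a condition on all pairs, so the three conditions merge
    into one relation between letters. *)
Lemma row_condE k l s : all (gtn (k + l)) s ->
  row_cond k l s = sorted (row_ok k) s.
Proof.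
move=> hs; rewrite /row_cond !sorted_pairwise; try exact: leq_trans;
  try exact: ltn_trans; try exact: row_ok_trans.
rewrite !pairwise_filter -!pairwise_relI.
apply: (eq_in_pairwise _ hs) => x y; rewrite !inE /= /row_ok /unprimed /primed.
by lia.
Qed.

Lemma column_condE k l s : all (gtn (k + l)) s ->
  column_cond k l s = pairwise (fun x y => ~~ row_ok k y x) s.
Proof.
move=> hs; rewrite /column_cond !sorted_pairwise; try exact: leq_trans; try exact: ltn_trans.
rewrite !pairwise_filter -!pairwise_relI.
apply: (eq_in_pairwise _ hs) => x y; rewrite !inE /= /row_ok /unprimed /primed.
by lia.
Qed.

Definition values (n : nat) (F : seq (seq 'I_n)) : seq (seq nat) := map (map val) F.

Lemma bounded_values n (F : seq (seq 'I_n)) : bounded n (values F).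
Proof. by apply/allP => _ /mapP[s _ ->]; apply/allP => _ /mapP[x _ ->] /=. Qed.

Lemma hatE k l (F : filling k l) i j :
  hat F i j = nth (k + l) (nth [::] (values F) i) j.
Proof.
rewrite /hat /values; congr nth; have [lt_i | le_i] := ltnP i (size F).
  by rewrite (nth_map [::]).
by rewrite !nth_default // size_map.
Qed.

(** The value [k + l] of a missing cell falsifies the premises when it is read in [s] or in column
    [p] of [u], and the conclusions when it is read in column [p.+1] of [u]. *)
Lemma tripleE k l (s u : seq nat) p : all (gtn (k + l)) s -> all (gtn (k + l)) u ->
  let h := nth (k + l) in
  (unprimed k (h s p.+1) && (h u p <= h s p.+1) ==> (h u p.+1 < h s p.+1)) &&
  (primed k l (h s p.+1) && (h u p < h s p.+1) ==> (h u p.+1 <= h s p.+1)) =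
  ([&& p.+1 < size s, p < size u & row_ok k u.[p] s.[p.+1]] ==>
     (p.+1 < size u) && ~~ row_ok k s.[p.+1] u.[p.+1]).
Proof.
move=> /allP bs /allP bu /=.
have H (v : seq nat) q : (forall x, x \in v -> gtn (k + l) x) ->
    (q < size v /\ nth (k + l) v q = v.[q] /\ v.[q] < k + l) \/
    (size v <= q /\ nth (k + l) v q = k + l).
  move=> bv; have [lt_q | le_q] := ltnP q (size v); [left | right].
    by split=> //; split; [apply: set_nth_default | apply/bv/mem_nth].
  by rewrite nth_default.
have := H s p.+1 bs; have := H u p bu; have := H u p.+1 bu.
by rewrite /unprimed /primed /row_ok; lia.
Qed.

Lemma hctE k l (F : filling k l) : is_hct F = tableau k (values F).
Proof.
rewrite /is_hct /tableau.
have -> : is_composition (shape_of F) = ([::] \notin values F).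
  elim: (F) => //= s G IH; rewrite in_cons negb_or -IH; congr andb.
  by case: s.
case: (boolP ([::] \notin values F)) => //= F0.
have -> : all (fun s => row_cond k l [seq val x | x <- s]) F =
          all (sorted (row_ok k)) (values F).
  rewrite /values all_map; apply: eq_all => s /=; apply: row_condE.
  by apply/allP => _ /mapP[x _ ->] /=.
congr andb.
have b := bounded_values F; have sF : size F = size (values F) by rewrite size_map.
have F0' i : i < size F -> 0 < size (nth [::] (values F) i).
  rewrite sF => hi; have := mem_nth [::] hi; case: (nth _ _ i) => // h.
  by rewrite h in F0.
have bn i : i < size F -> all (gtn (k + l)) (nth [::] (values F) i).
  by rewrite sF => hi; apply: (allP b); apply: mem_nth.
have fc : first_column F = map (nth 0 ^~ 0) (values F).
  apply: (@eq_from_nth _ 0) => [|i]; rewrite !size_map ?size_iota // => hi.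
  rewrite (nth_map 0) ?size_iota // nth_iota // (nth_map [::]) -?sF // hatE.
  by apply: set_nth_default; apply: F0'.
rewrite fc column_condE; last first.
  apply/(all_nthP 0) => i; rewrite size_map -sF => hi; rewrite (nth_map [::]) -?sF //.
  by apply: (allP (bn i hi)); apply: mem_nth; apply: F0'.
rewrite pairwise_map; apply/andP/(pairwiseP [::]).
  case=> /(pairwiseP [::]) hc /forallP ht i j; rewrite !inE -sF => hi hj lt_ij.
  apply/rows_okP; split; first by apply: hc; rewrite ?inE -?sF.
  case=> // p /andP[_ hp] hq hr.
  (* As [p.+1] is a column of row [i], the column [p] lies in the range of the triple conditions. *)
  have hn : p < (largest_part F).-1.
    have : size (nth [::] (values F) i) <= largest_part F.
      rewrite /largest_part /shape_of /values (nth_map [::]) // size_map.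
      by apply: (@leq_bigmax_seq _ _ _ id); rewrite // map_f // mem_nth.
    by lia.
  move/forallP: (ht (Ordinal hi)) => /(_ (Ordinal hj)) /forallP /(_ (Ordinal hn)) /=.
  rewrite lt_ij /triple_cond_a /triple_cond_b !hatE /= tripleE ?bn //.
  by rewrite hp hq hr /= => /andP.
move=> h; split.
  by apply/(pairwiseP [::]) => i j hi hj lt_ij; have /rows_okP[] := h i j hi hj lt_ij.
apply/forallP => i; apply/forallP => j; apply/forallP => n; apply/implyP => lt_ij.
rewrite /triple_cond_a /triple_cond_b !hatE tripleE ?bn //.
apply/implyP => /and3P[h1 h2 h3].
have /rows_okP[_ /(_ n.+1) hn] : rows_ok k (nth [::] (values F) i) (nth [::] (values F) j).
  by apply: h; rewrite ?inE -?sF.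
by have [||| -> ->] := hn.
Qed.

Lemma values_surj n (F : seq (seq nat)) : bounded n F ->
  exists F' : seq (seq 'I_n), values F' = F.
Proof.
elim: F => [|s F IH] /=; first by exists [::].
case/andP=> hs /IH[F' <-]; exists (pmap insub s :: F'); congr cons.
by rewrite pmap_filter; [apply/all_filterP; apply: sub_all hs => x /=; rewrite isSome_insub | exact: insubK].
Qed.

Lemma values_inj n : injective (@values n).
Proof. by apply: inj_map; apply: inj_map; apply: val_inj. Qed.

(** * Tableaux as chains, matrices as lists of rows *)

Definition hct_chain k l (P : hct k l) : seq (seq nat) :=
  tableau_chain (k + l) (values (val P)).

Lemma hct_tableau k l (P : hct k l) : tableau k (values (val P)).
Proof. by rewrite -(@hctE k l); apply: valP. Qed.

Lemma hct_chainP k l (P : hct k l) : chain (letter_types k (k + l)) (hct_chain P).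
Proof. exact: tableau_chainP (hct_tableau P) (bounded_values _). Qed.

Lemma hct_chain_inj k l : injective (@hct_chain k l).
Proof.
move=> P P' e; apply/val_inj/values_inj.
exact: tableau_chain_inj (hct_tableau P) (bounded_values _)
  (hct_tableau P') (bounded_values _) e.
Qed.

Lemma hct_chain_surj k l c : chain (letter_types k (k + l)) c ->
  exists P : hct k l, hct_chain P = c.
Proof.
case/tableau_chain_surj=> F [tF bF <-]; have [F' eF] := values_surj bF.
have hF' : is_hct (F' : filling k l) by rewrite hctE eF.
by exists (exist _ F' hF'); rewrite /hct_chain /= eF.
Qed.

Lemma flatten_values n (F : seq (seq 'I_n)) : flatten (values F) = map val (flatten F).
Proof. by rewrite map_flatten. Qed.

Lemma weight_hct_chain k l (P : hct k l) c :
  weight P c = (weights (hct_chain P)).[rev_ord c].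
Proof.
rewrite (weights_tableau_chain (hct_tableau P) (bounded_values _) (ltn_ord _)).
rewrite flatten_values count_map /weight; apply: eq_count => x /=.
by rewrite -val_eqE /=; congr (_ == _); have := ltn_ord c; lia.
Qed.

Lemma shape_values n (F : seq (seq 'I_n)) : shape (values F) = [seq size s | s <- F].
Proof. by rewrite /shape -map_comp; apply: eq_map => s /=; rewrite size_map. Qed.

Lemma top_hct_chain k1 l1 k2 l2 (P : hct k1 l1) (Q : hct k2 l2) :
  (top (hct_chain P) == top (hct_chain Q)) = (shape_partition P == shape_partition Q).
Proof.
rewrite /hct_chain (top_tableau_chain (hct_tableau P)) ?bounded_values //.
rewrite (top_tableau_chain (hct_tableau Q)) ?bounded_values //.
have h k l (R : hct k l) : 0 \notin shape (values (val R)).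
  have /and3P[h _ _] := hct_tableau R.
  by apply: contra h => /mapP[s hs /esym/size0nil e]; rewrite -e.
by rewrite conj_inj_sort ?h // !shape_values.
Qed.

(** Rows and columns are reversed because chains start from the largest letter. *)
Definition matrix_rows n2 n1 (M : 'M[nat]_(n2, n1)) : seq (seq nat) :=
  [seq [seq M (rev_ord r) (rev_ord c) | c <- enum 'I_n1] | r <- enum 'I_n2].

Lemma nth_matrix_row n2 n1 (M : 'M[nat]_(n2, n1)) (r : 'I_n2) :
  nth [::] (matrix_rows M) r = [seq M (rev_ord r) (rev_ord c) | c <- enum 'I_n1].
Proof. by rewrite (nth_map r) ?size_enum_ord // nth_ord_enum. Qed.

Lemma nth_matrix_rows n2 n1 (M : 'M[nat]_(n2, n1)) (r : 'I_n2) (c : 'I_n1) :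
  (nth [::] (matrix_rows M) r).[c] = M (rev_ord r) (rev_ord c).
Proof. by rewrite nth_matrix_row (nth_map c) ?size_enum_ord // nth_ord_enum. Qed.

Lemma matrix_rows_inj n2 n1 : injective (@matrix_rows n2 n1).
Proof.
move=> M M' e; apply/matrixP => r c.
by rewrite -(rev_ordK r) -(rev_ordK c) -!nth_matrix_rows e.
Qed.

Lemma fitsP t ss m : reflect (size m = size ss /\
    forall i, i < size ss -> (nth false ss i != t) ==> (m.[i] <= 1)) (fits t ss m).
Proof.
elim: ss m => [|s ss IH] [|x m] /=; first [by constructor; split | by constructor; case | idtac].
apply: (iffP andP) => [[h /IH[-> hm]] | [[e] hm]].
  by split=> // -[|i] //= /hm.
by split; [apply: (hm 0) | apply/IH; split=> // i hi; apply: (hm i.+1)].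
Qed.

Lemma fits_rowsP ts ss M : reflect (size M = size ts /\
    forall j, j < size ts -> fits (nth false ts j) ss (nth [::] M j)) (fits_rows ts ss M).
Proof.
elim: ts M => [|t ts IH] [|m M] /=; first [by constructor; split | by constructor; case | idtac].
apply: (iffP andP) => [[h /IH[-> hm]] | [[e] hm]].
  by split=> // -[|i] //= /hm.
by split; [apply: (hm 0) | apply/IH; split=> // i hi; apply: (hm i.+1)].
Qed.

Lemma size_letter_types k n : size (letter_types k n) = n.
Proof. by elim: n => //= n ->. Qed.

Lemma nth_letter_types k n (i : 'I_n) : nth false (letter_types k n) i = (k <= rev_ord i).
Proof.
case: i => i /=; elim: n i => // n IH [|i] /= hi; first by rewrite subSS subn0.
by rewrite IH // subSS.
Qed.

Lemma hook_matrixE k1 l1 k2 l2 (M : 'M[nat]_(k2 + l2, k1 + l1)) :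
  is_hook_matrix M = [forall r, forall c, ((k1 <= val c) != (k2 <= val r)) ==> (M r c <= 1)].
Proof.
apply/andP/forallP => [[/forallP h1 /forallP h2] r | h].
  apply/forallP => c; apply/implyP.
  have := splitK r; have := splitK c.
  case: (split r) => i <-; case: (split c) => j <- /= hij.
  - by have := ltn_ord i; have := ltn_ord j; move: hij => /=; lia.
  - by have /forallP/(_ j) := h1 i; rewrite !mxE.
  - by have /forallP/(_ j) := h2 i; rewrite !mxE.
  by move: hij => /=; rewrite !leq_addr.
split; apply/forallP => i; apply/forallP => j.
  have /forallP/(_ (rshift k1 j))/implyP := h (lshift l2 i).
  by rewrite !mxE /= leq_addr leqNgt ltn_ord; apply.
have /forallP/(_ (lshift l1 j))/implyP := h (rshift k2 i).
by rewrite !mxE /= leq_addr leqNgt ltn_ord; apply.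
Qed.

Lemma fits_matrix_rows k1 l1 k2 l2 (M : 'M[nat]_(k2 + l2, k1 + l1)) :
  fits_rows (letter_types k2 (k2 + l2)) (letter_types k1 (k1 + l1)) (matrix_rows M) =
  is_hook_matrix M.
Proof.
rewrite hook_matrixE; apply/fits_rowsP/forallP; rewrite !size_letter_types.
  case=> _ h r; apply/forallP => c; have /fitsP[_] := h (rev_ord r) (ltn_ord _).
  rewrite size_letter_types => /(_ (rev_ord c) (ltn_ord _)).
  by rewrite !nth_letter_types nth_matrix_rows !rev_ordK.
move=> h; split; first by rewrite size_map size_enum_ord.
move=> r hr; rewrite -[r]/(val (Ordinal hr)); apply/fitsP.
rewrite size_letter_types nth_matrix_row size_map size_enum_ord; split=> // c hc.
rewrite -nth_matrix_row -[c]/(val (Ordinal hc)) nth_matrix_rows !nth_letter_types.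
by have /forallP/(_ (rev_ord (Ordinal hc))) := h (rev_ord (Ordinal hr)).
Qed.

Lemma matrix_rows_surj k2 n2 k1 n1 M :
  fits_rows (letter_types k2 n2) (letter_types k1 n1) M ->
  exists A : 'M[nat]_(n2, n1), matrix_rows A = M.
Proof.
case/fits_rowsP; rewrite size_letter_types => sM h.
exists (\matrix_(r, c) nth 0%N (nth [::] M (rev_ord r)) (rev_ord c))%R.
apply: (@eq_from_nth _ [::]) => [|r]; rewrite size_map size_enum_ord // => hr.
rewrite -[r]/(val (Ordinal hr)) nth_matrix_row.
have /fitsP[] := h r hr; rewrite size_letter_types => sr _.
apply: (@eq_from_nth _ 0) => [|c]; rewrite size_map size_enum_ord // => hc.
rewrite -[c]/(val (Ordinal hc)) (nth_map (Ordinal hc)) ?size_enum_ord //.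
by rewrite nth_ord_enum mxE !rev_ordK.
Qed.

(** * The correspondence *)

Section SuperRSK.

Variables k1 l1 k2 l2 : nat.
Let n1 := k1 + l1.
Let n2 := k2 + l2.

(** A boolean relation, from which both maps are obtained by choice: tableaux need not be computed
    from their chains. *)
Definition corresponds (M : hook_matrix k1 l1 k2 l2) (PQ : hct_pair k1 l1 k2 l2) : bool :=
  insert_rows (letter_types k2 n2) (letter_types k1 n1) (matrix_rows (val M)) ==
  (hct_chain (val PQ).1, hct_chain (val PQ).2).

Lemma fits_hook_matrix (M : hook_matrix k1 l1 k2 l2) :
  fits_rows (letter_types k2 n2) (letter_types k1 n1) (matrix_rows (val M)).
Proof. by rewrite fits_matrix_rows; apply: valP. Qed.

Lemma corresponds_total M : exists PQ, corresponds M PQ.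
Proof.
have [[cP cQ tPQ] _] := insert_rows_sound (fits_hook_matrix M).
have [P eP] := hct_chain_surj cP; have [Q eQ] := hct_chain_surj cQ.
have h : shape_partition P == shape_partition Q by rewrite -top_hct_chain eP eQ tPQ.
exists (exist _ (P, Q) h); rewrite /corresponds /= eP eQ.
by rewrite -surjective_pairing.
Qed.

Lemma corresponds_surj PQ : exists M, corresponds M PQ.
Proof.
case: PQ => -[P Q] h; have tPQ := h; rewrite -top_hct_chain in tPQ.
have [M0 fM eM] := insert_rows_surj (hct_chainP P) (hct_chainP Q) (eqP tPQ).
have [M eM0] := matrix_rows_surj fM.
have hM : is_hook_matrix M by rewrite -fits_matrix_rows eM0.
by exists (exist _ M hM); rewrite /corresponds /= eM0 eM.
Qed.

Lemma corresponds_inj M M' PQ : corresponds M PQ -> corresponds M' PQ -> M = M'.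
Proof.
move=> /eqP e /eqP e'; apply/val_inj/matrix_rows_inj.
by apply: insert_rows_inj (fits_hook_matrix _) (fits_hook_matrix _) _; rewrite e e'.
Qed.

Lemma corresponds_functional M PQ PQ' : corresponds M PQ -> corresponds M PQ' -> PQ = PQ'.
Proof.
move=> /eqP e; rewrite /corresponds e => /eqP[/hct_chain_inj e1 /hct_chain_inj e2].
apply: val_inj.
by rewrite [LHS]surjective_pairing e1 e2 -surjective_pairing.
Qed.

Lemma corresponds_weight M PQ : corresponds M PQ ->
  (forall c, weight (val PQ).1 c = \sum_(r < n2) val M r c) /\
  (forall r, weight (val PQ).2 r = \sum_(c < n1) val M r c).
Proof.
move=> /eqP e; have [_ [w1 w2]] := insert_rows_sound (fits_hook_matrix M).
rewrite e /= in w1 w2; split=> [c | r]; rewrite weight_hct_chain.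
  rewrite w1 big_map big_enum (reindex_inj rev_ord_inj); apply: eq_bigr => r _.
  by rewrite (nth_map c) ?size_enum_ord ?ltn_ord // nth_ord_enum !rev_ordK.
rewrite w2 nth_matrix_row sumnE big_map big_enum rev_ordK.
by rewrite [RHS](reindex_inj rev_ord_inj).
Qed.

End SuperRSK.

Theorem theorem6p3 (k1 l1 k2 l2 : nat) :
  exists f : hook_matrix k1 l1 k2 l2 -> hct_pair k1 l1 k2 l2,
    bijective f /\
    forall M : hook_matrix k1 l1 k2 l2,
      (forall c : 'I_(k1 + l1),
         weight (val (f M)).1 c = \sum_(r < k2 + l2) val M r c) /\
      (forall r : 'I_(k2 + l2),
         weight (val (f M)).2 r = \sum_(c < k1 + l1) val M r c).
Proof.
pose f M := xchoose (@corresponds_total k1 l1 k2 l2 M).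
pose g PQ := xchoose (@corresponds_surj k1 l1 k2 l2 PQ).
have fP M : corresponds M (f M) := xchooseP (corresponds_total M).
have gP PQ : corresponds (g PQ) PQ := xchooseP (corresponds_surj PQ).
exists f; split; last by move=> M; apply: corresponds_weight.
exists g => [M | PQ]; first exact: corresponds_inj (gP _) (fP _).
exact: corresponds_functional (fP _) (gP _).
Qed.
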